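(* Let $s$ be a fixed integer with $s>0$ and $s\neq 4$. Then there exists an integer $S(s)$ such that for every integer $m\ge S(s)$, the maximal spectral radius of a digraph with exactly $(m+1)^2-s$ edges is achieved by the digraph $G(m,2m+1-s)$; that is, every digraph with exactly $(m+1)^2-s$ edges has spectral radius at most that of $G(m,2m+1-s)$.
   Context: A digraph is a finite directed graph with no multiple edges, but possibly with loops (so edges are ordered pairs of vertices, and a loop counts as one edge). The spectral radius of a digraph is the spectral radius of its (0-1) adjacency matrix. For integers $m\geq 1$ and $0\le p,q\le m$, $G(m,p,q)$ denotes the digraph on the vertex set $\{1,\dots,m+1\}$ in which there is an edge from $i$ to $j$ if and only if one of the following holds: (1) $i,j\le m$; (2) $i\le p$ and $j=m+1$; (3) $i=m+1$ and $j\le q$. It has $m^2+p+q$ edges. For $0<\ell<2m+1$, put $G(m,\ell)=G(m,\lceil \ell/2\rceil,\ \ell-\lceil \ell/2\rceil)$; it has $m^2+\ell$ edges. (For fixed $s>0$ and $m$ large, $\ell=2m+1-s$ satisfies $0<\ell<2m+1$, and $m^2+\ell=(m+1)^2-s$.) *)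

(* Defs.v *)
From HB Require Import structures.
From mathcomp Require Import all_boot all_order all_algebra.
From mathcomp Require Import reals complex.

Set Implicit Arguments.
Unset Strict Implicit.
Unset Printing Implicit Defensive.

Import Order.TTheory GRing.Theory Num.Theory.

Local Open Scope ring_scope.

(* A digraph is a finite vertex type V with an arbitrary relation e : rel V:
   loops are allowed, multiple edges are not. *)

Definition num_edges (V : finType) (e : rel V) : nat :=
  #|[set uv : V * V | e uv.1 uv.2]|.

Definition adjacency (R : realType) (V : finType) (e : rel V) : 'M[R]_#|V| :=
  \matrix_(i, j) (e (enum_val i) (enum_val j))%:R.

(* The complex eigenvalues of a real matrix, with algebraic multiplicity. *)
Definition spectrum (R : realType) (n : nat) (A : 'M[R]_n) : seq R[i] :=
  sval (closed_field_poly_normal (char_poly (map_mx (real_complex R) A))).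

(* The default 0 matters only for the empty matrix: moduli are nonnegative. *)
Definition spectral_radius (R : realType) (n : nat) (A : 'M[R]_n) : R :=
  \big[Num.max/0]_(z <- spectrum A) Normc.normc z.

Definition digraph_radius (R : realType) (V : finType) (e : rel V) : R :=
  spectral_radius (adjacency R e).

(* G(m,p,q), with the vertex set {1, ..., m+1} shifted to {0, ..., m}, so that
   "i <= p" for 1-based labels reads i < p here. *)
Definition Gmpq (m p q : nat) : rel 'I_m.+1 :=
  fun i j => [|| (i < m)%N && (j < m)%N,
                 (i < p)%N && (j == m :> nat)
               | (i == m :> nat) && (j < q)%N].
Arguments Gmpq : clear implicits.

(* uphalf l is the ceiling of l / 2. *)
Definition Gml (m l : nat) : rel 'I_m.+1 :=
  Gmpq m (uphalf l) (l - uphalf l)%N.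
Arguments Gml : clear implicits.

(* Main.v *)
Require Import Defs.
From HB Require Import structures.
From mathcomp Require Import all_boot all_order all_algebra.
From mathcomp Require Import reals complex.
From mathcomp Require Import zify ring lra.

Set Implicit Arguments.
Unset Strict Implicit.
Unset Printing Implicit Defensive.

Import Order.TTheory GRing.Theory Num.Theory.

Local Open Scope ring_scope.

(** Write n = m + 1 and let A be the adjacency matrix of a digraph with n^2 - s
    edges.  When A lives on n vertices, A = J - Z with J the all-ones matrix and Z
    having s ones, and a positive eigenvector gives, for the radius r,

      r = n - s/r + w2/r^2 - w3/r^3 + ...,

    where wk counts the walks with k edges in Z.  For n large the radius is thus
    decided by maximizing w2 = sum of indegree * outdegree over the s-edge digraphs
    Z, then by minimizing w3.  The best Z is a vertex with a loop and evenly divided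
    in- and out-edges, a hook once the vertices are ordered.  At s = 4 the full 2 x 2
    block has w2 = 8 against 7 for the hook, hence the exclusion.

    The comparison is with one real number r: a root in [n-1, n] of the cubic
      (n - r)(r^2 + r - a) = s r - a(b + 1),   a + b + 1 = s,  a <= b <= a + 1,
    which is an eigenvalue of the extremal digraph (Gmpq_radius), so its radius is at
    least r.  It remains to bound every other radius by r.

    Any eigenvalue z of A gives a vector x >= 0 with |z| x <= A x.  Sorting x and
    rearranging the edges turns A into a Young diagram with as many cells without
    losing the inequality (young_rearrangement).  If y >= 0 satisfies y A <= r y and
    y x > 0, then |z| <= r (dual_test); suitable y are truncated Neumann series.

    Suppose |z| > r.  The Durfee square of the diagram has side d with n - d bounded
    in terms of s (durfee_square), and the cells outside it must form n - d nearly
    full arms (arms_product), so that only a bounded number k of cells lie outside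
    the n x n square (arms_bounded).  If k > 0, then s + k cells are missing inside,
    which costs k/r to first order and gains only O(1/r^2) (block_test).  If k = 0,
    the missing cells form a Young diagram of size s, and w2 decides
    (paths_lt_hook): it is smaller than for the balanced hook, except for the hook
    and its transpose, which have the same radius, and for the staircase 3 + 2 + 1
    when s = 6, where w3 decides (square_bound). *)

(** * Two-step walks in a Young diagram *)

(** A Young diagram is encoded as a downset of cells, rows and columns numbered from
    0; the same relation is read as a digraph on nat. *)
Definition downset (Y : rel nat) : Prop :=
  forall i j i' j', (i' <= i)%N -> (j' <= j)%N -> Y i j -> Y i' j'.

Definition row_len (N : nat) (Y : rel nat) (i : nat) : nat :=
  (\sum_(0 <= j < N) Y i j)%N.

Definition col_len (N : nat) (Y : rel nat) (j : nat) : nat :=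
  (\sum_(0 <= i < N) Y i j)%N.

Definition cells (N : nat) (Y : rel nat) : nat :=
  (\sum_(0 <= i < N) row_len N Y i)%N.

(** Walks with two edges, counted by their middle vertex. *)
Definition paths (N : nat) (Y : rel nat) : nat :=
  (\sum_(0 <= j < N) col_len N Y j * row_len N Y j)%N.

Definition strip_hook (Y : rel nat) : rel nat := fun i j => Y i.+1 j.+1.

Lemma downset_strip_hook (Y : rel nat) : downset Y -> downset (strip_hook Y).
Proof. by move=> dY i j i' j' hi hj; apply: dY. Qed.

Lemma cells_col (N : nat) (Y : rel nat) :
  cells N Y = (\sum_(0 <= j < N) col_len N Y j)%N.
Proof. by rewrite /cells /row_len exchange_big_nat. Qed.

Lemma cells_peel (N : nat) (Y : rel nat) :
  Y 0%N 0%N ->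
  cells N.+1 Y = (row_len N (fun i j => Y i j.+1) 0 +
                  col_len N (fun i j => Y i.+1 j) 0 + 1 + cells N (strip_hook Y))%N.
Proof.
move=> Y00; rewrite /cells /row_len /col_len big_nat_recl // big_nat_recl // Y00.
have -> : (\sum_(0 <= i < N) \sum_(0 <= j < N.+1) Y i.+1 j =
    \sum_(0 <= i < N) (Y i.+1 0 + \sum_(0 <= j < N) Y i.+1 j.+1))%N.
  by apply: eq_bigr => i _; rewrite big_nat_recl.
by rewrite big_split /= /strip_hook; lia.
Qed.

(** A vertex other than the corner gains at most one in-edge and one out-edge from
    the hook.  Expanding the product of its degrees, the cross terms add up to at
    most two per remaining cell, and the hook alone contributes a further walk only
    where both of its arms reach. *)
Lemma paths_peel (N : nat) (Y : rel nat) :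
  downset Y -> Y 0%N 0%N ->
  let p := row_len N (fun i j => Y i j.+1) 0 in
  let q := col_len N (fun i j => Y i.+1 j) 0 in
  (paths N.+1 Y <= p.+1 * q.+1 + minn p q + 2 * cells N (strip_hook Y)
                   + paths N (strip_hook Y))%N.
Proof.
move=> dY Y00; set p := row_len _ _ _; set q := col_len _ _ _ => /=.
rewrite {1}/paths big_nat_recl //.
have -> : (col_len N.+1 Y 0 * row_len N.+1 Y 0 = p.+1 * q.+1)%N.
  by rewrite /col_len /row_len !big_nat_recl // Y00 mulnC.
rewrite -!addnA leq_add2l.
rewrite (@leq_trans (\sum_(0 <= j < N) ((Y 0 j.+1 && Y j.+1 0)
   + (row_len N (strip_hook Y) j + col_len N (strip_hook Y) j)
   + col_len N (strip_hook Y) j * row_len N (strip_hook Y) j))%N) //.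
  apply: leq_sum => j _.
  have -> : col_len N.+1 Y j.+1 = (Y 0%N j.+1 + col_len N (strip_hook Y) j)%N.
    by rewrite /col_len big_nat_recl.
  have -> : row_len N.+1 Y j.+1 = (Y j.+1 0%N + row_len N (strip_hook Y) j)%N.
    by rewrite /row_len big_nat_recl.
  move: (col_len N (strip_hook Y) j) (row_len N (strip_hook Y) j) => u v.
  by case: (Y 0%N j.+1); case: (Y j.+1 0%N) => /=; nia.
rewrite !big_split /= -cells_col -/(cells _ _) -/(paths _ _).
have : (\sum_(0 <= j < N) (Y 0 j.+1 && Y j.+1 0) <= minn p q)%N.
  rewrite leq_min; apply/andP; split; apply: leq_sum => j _;
  by case: (Y 0%N j.+1); case: (Y j.+1 0%N).
lia.
Qed.

Lemma cells_strip_hook_le (N : nat) (Y : rel nat) :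
  downset Y ->
  (cells N (strip_hook Y) <= row_len N (fun i j => Y i j.+1) 0 *
                        col_len N (fun i j => Y i.+1 j) 0)%N.
Proof.
move=> dY; rewrite mulnC /col_len big_distrl /=; apply: leq_sum => i _.
rewrite big_distrr /=; apply: leq_sum => j _; rewrite /strip_hook.
case h: (Y i.+1 j.+1) => //.
by rewrite (dY _ _ _ _ (leqnn _) (leq0n _) h) (dY _ _ _ _ (leq0n _) (leqnn _) h).
Qed.

Lemma cells_empty (N : nat) (Y : rel nat) :
  downset Y -> ~~ Y 0%N 0%N -> cells N Y = 0%N /\ paths N Y = 0%N.
Proof.
move=> dY nY; have Y0 i j : Y i j = false.
  by apply/negbTE/(contra _ nY)/dY.
rewrite /cells /paths /row_len; split; apply: big1 => i _;
  by rewrite big1 ?muln0 // => j _; rewrite Y0.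
Qed.

(** With D = |p - q|, four times the left-hand bracket is exactly
    H^2 + 4H - 1 - D^2 - 2D, where H = p + q + 1 is the size of the hook. *)
Lemma hook_paths_le (p q : nat) :
  (4 * (p.+1 * q.+1 + minn p q) + 1 <= (p + q + 1) ^ 2 + 4 * (p + q + 1))%N.
Proof. nia. Qed.

(** Removing a hook of size H from a diagram of size c and leaving t cells loses
    1 + 2t(H - 4) in the bound c^2 + 4c, so hooks with H >= 4 are harmless, and
    below that only the 2 x 2 square has t > 0; it attains equality.  The extra
    term records that c = 4 is the only nonempty size with equality. *)
Lemma paths_le (N : nat) (Y : rel nat) :
  downset Y ->
  (4 * paths N Y + ((cells N Y != 0) && (cells N Y != 4))
     <= cells N Y ^ 2 + 4 * cells N Y)%N.
Proof.
elim: N Y => [|N IH] Y dY; first by rewrite /paths /cells !big_nil.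
have [Y00|nY] := boolP (Y 0%N 0%N); last by case: (cells_empty N.+1 dY nY) => -> ->.
have := paths_peel N dY Y00; have := cells_strip_hook_le N dY.
have := leq_trans (leq_addr _ _) (IH _ (downset_strip_hook dY)); rewrite cells_peel //=.
move: (row_len _ _ _) (col_len _ _ _) (cells _ _) (paths N.+1 _) (paths N _).
move=> p q t P P' h1 h2 h3.
have := hook_paths_le p q; move: (minn p q) h3 => mn h3 hA.
have [h4|h4] := leqP 4 (p + q + 1).
  move: (p.+1 * q.+1)%N (p + q + 1)%N hA h3 h4 => K H hA h3 h4.
  have : (4 * t <= H * t)%N by rewrite leq_mul2r h4 orbT.
  by rewrite sqrnD; case: (_ && _); lia.
have [t0|t0] := posnP t; first by subst t; case: (_ && _); lia.
have [? ?] : p = 1%N /\ q = 1%N.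
  by case: p q h2 h4 {h3 hA} => [|[|[|p]]] [|[|[|q]]]; lia.
subst p q; have t1 : t = 1%N by lia.
by subst t; lia.
Qed.

(** The right-hand side of the inequality is the number of two-step walks in the
    balanced hook with arms a and b.  The second case is that hook or its transpose,
    the third is the staircase with rows 3, 2, 1, which ties with it. *)
Lemma paths_lt_hook (N : nat) (Y : rel nat) (a b : nat) :
  downset Y -> cells N.+1 Y = (a + b + 1)%N -> (a <= b <= a.+1)%N ->
  (a + b + 1)%N <> 4%N ->
  let p := row_len N (fun i j => Y i j.+1) 0 in
  let q := col_len N (fun i j => Y i.+1 j) 0 in
  let t := cells N (strip_hook Y) in
  [\/ (paths N.+1 Y < a.+1 * b.+1 + a)%N,
      t = 0%N /\ ((p = a /\ q = b) \/ (p = b /\ q = a)) |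
      [/\ t = 1%N, p = 2%N, q = 2%N, a = 2%N & b = 3%N]].
Proof.
move=> dY cY hab h4 p q t.
have [Y00|nY] := boolP (Y 0%N 0%N); last first.
  by move: cY; case: (cells_empty N.+1 dY nY) => ->; lia.
have := paths_peel N dY Y00; have := cells_strip_hook_le N dY.
have := paths_le N (downset_strip_hook dY).
move: cY; rewrite cells_peel //= -/p -/q -/t.
move: (paths N.+1 _) (paths N _) => P P' cY.
move: p q t cY => p q t cY h1 h2 h3.
have [t0|t0] := posnP t.
  have [?|?] := boolP (((p == a) && (q == b)) || ((p == b) && (q == a))).
    by constructor 2; split=> //; lia.
  constructor 1; subst t.
  have : (p.+1 * q.+1 + minn p q < a.+1 * b.+1 + a)%N by nia.
  by move: h1 h3; lia.
have [h5|h5] := boolP ((t == 1) && (p == 2) && (q == 2))%N.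
  by constructor 3; split; lia.
constructor 1.
have E : ((a + b + 1) ^ 2 + 4 * (a + b + 1) <= 4 * (a.+1 * b.+1 + a) + 4)%N.
  have [e|e] : (b = a \/ b = a.+1)%N by lia.
    by subst b; lia.
  by subst b; lia.
have hA := hook_paths_le p q.
have [H6|H6] := leqP 6 (p + q + 1).
  suff : (4 * P + 4 < (a + b + 1) ^ 2 + 4 * (a + b + 1))%N by lia.
  move: h1 {h2 h5 hab h4 E}; rewrite -cY.
  move: (p.+1 * q.+1 + minn p q)%N (p + q + 1)%N hA h3 H6 => K H hA h3 H6 h1.
  have : (6 * t <= H * t)%N by rewrite leq_mul2r H6 orbT.
  by move: (_ && _) h1 => bb h1; rewrite sqrnD; lia.
(* A first hook of size at most 5 leaves finitely many shapes. *)
case: p q h2 H6 h5 cY h3 {hA} => [|[|[|[|[|p]]]]] [|[|[|[|[|q]]]]]; lia.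
Qed.


(** * Shapes of the extremal diagrams *)
Lemma len_le (n : nat) (f : nat -> bool) : (\sum_(0 <= i < n) f i <= n)%N.
Proof.
rewrite -[X in (_ <= X)%N](subn0 n) -[X in (_ <= X)%N]muln1 -sum_nat_const_nat.
by apply: leq_sum => i _; case: (f i).
Qed.

Lemma initial_segment (f : nat -> bool) (N p : nat) :
  (forall i j, (i <= j)%N -> f j -> f i) ->
  (\sum_(0 <= j < N) f j)%N = p -> forall j, (j < N)%N -> f j = (j < p)%N.
Proof.
move=> fd <- {p}; elim: N => [//|N IH] j hj.
rewrite big_nat_recr //=; case fN: (f N).
  have all1 i : (i <= N)%N -> f i by move=> h; apply: fd h fN.
  have -> : (\sum_(0 <= i < N) f i = N)%N.
    rewrite (eq_big_nat _ _ (F2 := fun=> 1%N)) ?sum_nat_const_nat ?subn0 ?muln1 //.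
    by move=> i /andP[_ h]; rewrite all1 // ltnW.
  by rewrite all1 // addn1 hj.
rewrite addn0; move: hj; rewrite ltnS leq_eqVlt => /orP[/eqP ->|]; last exact: IH.
by rewrite fN; apply/esym/negbTE; rewrite -leqNgt len_le.
Qed.

Lemma hook_shape (N p q : nat) (Y : rel nat) :
  downset Y -> Y 0%N 0%N -> cells N (strip_hook Y) = 0%N ->
  row_len N (fun i j => Y i j.+1) 0 = p ->
  col_len N (fun i j => Y i.+1 j) 0 = q ->
  forall i j, (i <= N)%N -> (j <= N)%N ->
  Y i j = ((i == 0%N) && (j <= p)%N) || ((j == 0%N) && (i <= q)%N).
Proof.
move=> dY Y00 t0 hp hq.
have rowE j : (j < N)%N -> Y 0%N j.+1 = (j < p)%N.
  by apply: (initial_segment _ hp) => i k hik; apply: dY.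
have colE i : (i < N)%N -> Y i.+1 0%N = (i < q)%N.
  by apply: (initial_segment _ hq) => k l hkl; apply: dY.
case=> [|i] [|j] hi hj //=.
- by rewrite rowE // orbF.
- by rewrite colE.
apply/negbTE/negP => Yij; move/eqP: t0; rewrite -leqn0 leqNgt => /negP; apply.
have [N' e] : exists N', N = N'.+1 by exists N.-1; lia.
subst N; rewrite (cells_peel _ (_ : strip_hook Y 0 0)) ?addn1 //.
by apply: dY Yij.
Qed.

Lemma staircase_shape (N : nat) (Y : rel nat) :
  downset Y -> Y 0%N 0%N -> cells N (strip_hook Y) = 1%N ->
  row_len N (fun i j => Y i j.+1) 0 = 2%N ->
  col_len N (fun i j => Y i.+1 j) 0 = 2%N ->
  forall i j, (i <= N)%N -> (j <= N)%N -> Y i j = (i + j <= 2)%N.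
Proof.
move=> dY Y00 t1 hp hq.
have rowE j : (j < N)%N -> Y 0%N j.+1 = (j < 2)%N.
  by apply: (initial_segment _ hp) => i k hik; apply: dY.
have colE i : (i < N)%N -> Y i.+1 0%N = (i < 2)%N.
  by apply: (initial_segment _ hq) => k l hkl; apply: dY.
case=> [|i] [|j] hi hj //=.
- by rewrite rowE.
- by rewrite colE // addn0.
have [N' e] : exists N', N = N'.+1 by exists N.-1; lia.
subst N; have S00 : strip_hook Y 0%N 0%N.
  by apply/negPn/negP => /(cells_empty N'.+1 (downset_strip_hook dY))[]; rewrite t1.
have := t1; rewrite cells_peel // => h.
rewrite -[Y _ _]/(strip_hook Y i j).
rewrite (@hook_shape N' 0 0 _ (downset_strip_hook dY)) //; lia.
Qed.

(** * Bounding the radius by a dual vector *)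

(** What remains of a Perron vector after the rearrangement.  The first coordinate
    is then the largest one, and its positivity says that x is not 0. *)
Definition subinvariant (R : realFieldType) (N : nat) (Y : rel nat) (rho : R)
  (x : nat -> R) : Prop :=
  [/\ forall i, 0 <= x i, forall i j, (i <= j)%N -> x j <= x i, 0 < x 0%N &
      forall i, rho * x i <= \sum_(0 <= j < N) (Y i j)%:R * x j].

Lemma term_le_sum (R : realFieldType) (n j : nat) (F : nat -> R) :
  (forall i, (i < n)%N -> 0 <= F i) -> (j < n)%N -> F j <= \sum_(0 <= i < n) F i.
Proof.
move=> F0 hj; rewrite big_mkord (bigD1 (Ordinal hj)) //= lerDl.
by apply: sumr_ge0 => i _; apply: F0.
Qed.

Lemma natr_sum_nat (R : realFieldType) (m n : nat) (F : nat -> nat) :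
  ((\sum_(m <= i < n) F i)%N)%:R = \sum_(m <= i < n) (F i)%:R :> R.
Proof. by rewrite natr_sum. Qed.

(** Pair both inequalities: rho y x <= y A x <= r y x, and y x > 0 because its term
    of index 0 is positive. *)
Lemma dual_test (R : realFieldType) (N : nat) (Y : rel nat) (rho r : R)
  (x y : nat -> R) :
  (0 < N)%N -> subinvariant N Y rho x ->
  (forall i, (i < N)%N -> 0 <= y i) -> 0 < y 0%N ->
  (forall j, (j < N)%N -> \sum_(0 <= i < N) (Y i j)%:R * y i <= r * y j) ->
  rho <= r.
Proof.
move=> N0 [x0 xd xp hx] y0 yp hy.
have S0 : 0 < \sum_(0 <= i < N) y i * x i.
  apply: lt_le_trans (term_le_sum (j := 0%N) (F := fun i => y i * x i) _ N0).
    by rewrite mulr_gt0.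
  by move=> i hi; rewrite mulr_ge0 ?y0.
rewrite -(ler_pM2r S0) !mulr_sumr.
apply: (@le_trans _ _ (\sum_(0 <= i < N) \sum_(0 <= j < N) y i * ((Y i j)%:R * x j))).
  apply: ler_sum_nat => i /andP[_ hi]; rewrite -mulr_sumr mulrCA.
  by rewrite ler_wpM2l // y0.
rewrite exchange_big_nat /=; apply: ler_sum_nat => j /andP[_ hj].
rewrite mulrA; apply: le_trans (ler_wpM2r (x0 j) (hy j hj)).
by rewrite mulr_suml le_eqVlt; apply/orP; left; apply/eqP/eq_bigr => i _; ring.
Qed.

Lemma sum_cut (R : nmodType) (n N : nat) (F : nat -> R) : (n <= N)%N ->
  \sum_(0 <= i < N) F i = \sum_(0 <= i < n) F i + \sum_(n <= i < N) F i.
Proof. by move=> h; rewrite (@big_cat_nat _ _ _ n). Qed.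

(** Here A = J - Z on the first n indices, with further ones to the right of and
    below that block.  The dual vector is the Neumann series 1 - 1Z/r + ... cut
    after the second order inside the block, where q / r^2 also pays for the outside
    rows, and 2 c / r on an outside index whose column meets the block in c cells:
    the factor 2 bounds the coordinates inside.  Its coordinates in the block then
    sum to n - (number of zeros)/r + Q/r^2. *)
Lemma block_test (R : realFieldType) (n N : nat) (Y : rel nat) (rho r : R)
  (x : nat -> R) :
  (0 < n <= N)%N -> (forall i j, (n <= i)%N -> (n <= j)%N -> ~~ Y i j) ->
  subinvariant N Y rho x ->
  let Z : rel nat := fun i j => ~~ Y i j in
  let Q := (paths n Z + 2 * \sum_(n <= v < N) col_len n Y v * row_len n Y v)%N in
  0 < r -> (cells n Z)%:R < r -> Q%:R <= r ^+ 2 ->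
  n%:R - (cells n Z)%:R / r + Q%:R / r ^+ 2 <= r ->
  rho <= r.
Proof.
move=> /andP[n0 nN] Yout sx Z Q r0 zr Qr hr.
pose inn j : R := (col_len n Z j)%:R.
pose q j : R := \sum_(0 <= i < n) (Z i j)%:R * inn i
   + 2 * \sum_(n <= v < N) (Y v j)%:R * (col_len n Y v)%:R.
pose y j : R := if (j < n)%N then 1 - inn j / r + q j / r ^+ 2
   else 2 * (col_len n Y j)%:R / r.
have q0 j : 0 <= q j.
  rewrite addr_ge0 ?mulr_ge0 //; apply: sumr_ge0 => i _; rewrite mulr_ge0 ?ler0n //.
have innz j : (j < n)%N -> inn j <= (cells n Z)%:R.
  by move=> hj; rewrite cells_col natr_sum_nat; apply: term_le_sum.
have qsum : \sum_(0 <= j < n) q j = Q%:R.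
  rewrite big_split /= -mulr_sumr natrD natrM; congr (_ + _ * _).
    rewrite exchange_big_nat /paths natr_sum_nat; apply: eq_bigr => i _.
    by rewrite -mulr_suml natrM mulrC /row_len natr_sum_nat.
  rewrite exchange_big_nat natr_sum_nat; apply: eq_bigr => i _.
  by rewrite -mulr_suml natrM mulrC /row_len natr_sum_nat.
have qQ j : (j < n)%N -> q j <= Q%:R.
  by move=> hj; rewrite -qsum; apply: term_le_sum.
have r20 : 0 < r ^+ 2 by rewrite exprn_gt0.
have inn1 j : (j < n)%N -> inn j / r < 1.
  by move=> hj; rewrite ltr_pdivrMr // mul1r; apply: le_lt_trans (innz _ hj) zr.
have inn0 j : 0 <= inn j / r by rewrite divr_ge0 ?ler0n // ltW.
have q1 j : (j < n)%N -> q j / r ^+ 2 <= 1.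
  by move=> hj; rewrite ler_pdivrMr // mul1r; apply: le_trans (qQ _ hj) Qr.
have qq0 j : 0 <= q j / r ^+ 2 by rewrite divr_ge0 // ltW.
have y2 j : (j < n)%N -> 0 < y j <= 2.
  move=> hj; rewrite /y hj.
  by have := inn1 _ hj; have := inn0 j; have := q1 _ hj; have := qq0 j; lra.
apply: (dual_test (y := y) _ sx); first by apply: leq_trans nN.
- move=> i _; case: (ltnP i n) => hi; first by case/andP: (y2 _ hi) => /ltW.
  by rewrite /y ltnNge hi /= divr_ge0 ?mulr_ge0 // ltW.
- by case/andP: (y2 _ n0).
move=> j hj; rewrite (sum_cut _ nN).
have [jn|jn] := ltnP j n; last first.
  rewrite [X in _ + X]big_nat_cond [X in _ + X]big1 ?addr0; last first.
    by move=> i /andP[/andP[hi _] _]; rewrite (negbTE (Yout _ _ hi jn)) mul0r.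
  rewrite [y j]/y ltnNge jn /= mulrC divfK ?gt_eqF // mulrC /col_len natr_sum_nat mulr_suml.
  apply: ler_sum_nat => i /andP[_ hi]; rewrite ler_wpM2l //.
  by case/andP: (y2 _ hi).
have ysum : \sum_(0 <= i < n) y i <= r.
  apply: le_trans hr; rewrite le_eqVlt; apply/orP; left; apply/eqP.
  transitivity (\sum_(0 <= i < n) (1 - inn i / r + q i / r ^+ 2)).
    by apply: eq_big_nat => i /andP[_ hi]; rewrite /y hi.
  rewrite big_split /= -mulr_suml qsum; congr (_ + _).
  rewrite big_split /= sumrN -mulr_suml cells_col natr_sum_nat; congr (_ - _).
  by rewrite big_const_nat subn0 iter_addr_0.
have E1 : \sum_(0 <= i < n) (Y i j)%:R * y i <=
    \sum_(0 <= i < n) y i - inn j + (\sum_(0 <= i < n) (Z i j)%:R * inn i) / r.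
  rewrite /inn /col_len natr_sum_nat mulr_suml -sumrN -!big_split /=.
  apply: ler_sum_nat => i /andP[_ hi]; rewrite -/(inn i) -mulrA -/(col_len n Z i) -/(inn i) /Z.
  case: (Y i j) => /=; first by rewrite !mul0r mul1r subr0 addr0.
  rewrite !mul0r !mul1r /y hi; have := qq0 i; lra.
have E2 : \sum_(n <= i < N) (Y i j)%:R * y i =
    2 * (\sum_(n <= v < N) (Y v j)%:R * (col_len n Y v)%:R) / r.
  rewrite mulr_sumr mulr_suml; apply: eq_big_nat => i /andP[hi _].
  by rewrite /y ltnNge hi /=; ring.
rewrite E2 [y j]/y jn.
have -> : r * (1 - inn j / r + q j / r ^+ 2) = r - inn j + q j / r.
  by field; rewrite gt_eqF.
rewrite /q mulrDl; move: E1 ysum; lra.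
Qed.


(** * The comparison inside the n x n square *)

(** The missing cells, read from the opposite corner of the square so that they form
    a Young diagram again. *)
Definition corner_compl (n : nat) (Y : rel nat) : rel nat :=
  fun i j => [&& (i < n)%N, (j < n)%N & ~~ Y (n - i.+1)%N (n - j.+1)%N].

Lemma downset_corner_compl (n : nat) (Y : rel nat) :
  downset Y -> downset (corner_compl n Y).
Proof.
move=> dY i j i' j' hi hj /and3P[i_n j_n nY]; apply/and3P.
split; [exact: leq_ltn_trans i_n | exact: leq_ltn_trans j_n |].
by apply: contra nY; apply: dY; lia.
Qed.

Lemma row_len_corner_compl (n : nat) (Y : rel nat) (i : nat) : (i < n)%N ->
  row_len n (corner_compl n Y) i = row_len n (fun i j => ~~ Y i j) (n - i.+1).
Proof.
move=> hi; rewrite /row_len [RHS]big_nat_rev /=; apply: eq_big_nat => j /andP[_ hj].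
by rewrite /corner_compl hi hj.
Qed.

Lemma col_len_corner_compl (n : nat) (Y : rel nat) (j : nat) : (j < n)%N ->
  col_len n (corner_compl n Y) j = col_len n (fun i j => ~~ Y i j) (n - j.+1).
Proof.
move=> hj; rewrite /col_len [RHS]big_nat_rev /=; apply: eq_big_nat => i /andP[_ hi].
by rewrite /corner_compl hi hj.
Qed.

Lemma cells_corner_compl (n : nat) (Y : rel nat) :
  cells n (corner_compl n Y) = cells n (fun i j => ~~ Y i j).
Proof.
rewrite /cells [RHS]big_nat_rev /=; apply: eq_big_nat => i /andP[_ hi].
exact: row_len_corner_compl.
Qed.

Lemma paths_corner_compl (n : nat) (Y : rel nat) :
  paths n (corner_compl n Y) = paths n (fun i j => ~~ Y i j).
Proof.
rewrite /paths [RHS]big_nat_rev /=; apply: eq_big_nat => i /andP[_ hi].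
by rewrite row_len_corner_compl // col_len_corner_compl.
Qed.

(** The vector y is indexed from the opposite corner, like the missing cells. *)
Lemma square_test (R : realFieldType) (n N : nat) (Y : rel nat) (rho r : R)
  (x y : nat -> R) :
  (0 < n <= N)%N -> (forall i j, Y i j -> (i < n)%N /\ (j < n)%N) ->
  subinvariant N Y rho x ->
  (forall i, (i < n)%N -> 0 <= y i) -> 0 < y n.-1 ->
  \sum_(0 <= i < n) y i <= r ->
  (forall j, (j < n)%N ->
     r - \sum_(0 <= i < n) (corner_compl n Y i j)%:R * y i <= r * y j) ->
  rho <= r.
Proof.
move=> /andP[n0 nN] Ysup sx y0 yp ysum hy.
pose z i : R := if (i < n)%N then y (n - i.+1)%N else 0.
apply: (dual_test (y := z) _ sx); first exact: leq_trans nN.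
- by move=> i _; rewrite /z; case: ifP => // hi; apply: y0; lia.
- by rewrite /z n0 subn1.
move=> j _; have [jn|jn] := ltnP j n; last first.
  rewrite /z ltnNge jn mulr0 big1 // => i _.
  case Yij: (Y i j); last by rewrite mul0r.
  by case: (Ysup _ _ Yij); lia.
rewrite (sum_cut _ nN) [X in _ + X]big_nat_cond [X in _ + X]big1 ?addr0; last first.
  by move=> i /andP[/andP[hi _] _]; rewrite /z ltnNge hi mulr0.
have jn' : (n - j.+1 < n)%N by lia.
rewrite /z jn; apply: le_trans (hy _ jn'); rewrite lerBrDr.
apply: le_trans ysum; rewrite big_nat_rev -big_split /=.
apply: ler_sum_nat => i /andP[_ hi]; rewrite add0n.
have -> : (n - i.+1 < n)%N by lia.
have -> : (n - (n - i.+1).+1 = i)%N by lia.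
rewrite /corner_compl hi jn' /=.
have -> : (n - (n - j.+1).+1 = j)%N by lia.
by rewrite -mulrDl; case: (Y _ _); rewrite /= ?addr0 ?add0r mul1r.
Qed.

(** Arms of length p and q, not counting the corner. *)
Definition hook_rel (p q : nat) : rel nat := fun i j =>
  ((i == 0%N) && (j <= p)%N) || ((j == 0%N) && (i <= q)%N).

(** The corner coordinate g of the left eigenvector of J - hook_rel p q.  When the
    coordinates are scaled to sum to r, those that the row arm does not reach are 1
    and those on it are 1 - g/r; the equation of the corner column then gives g. *)
Definition hook_end (R : realFieldType) (p q : nat) (r : R) : R :=
  (r - q%:R) * r / (r ^+ 2 + r - (minn p q)%:R).

Definition hook_vec (R : realFieldType) (p q : nat) (r : R) (j : nat) : R :=
  if j is j'.+1 then 1 - (j' < p)%:R * (hook_end p q r / r) else hook_end p q r.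

Lemma sum_initial (R : realFieldType) (n p : nat) : (p <= n)%N ->
  \sum_(0 <= i < n) (i < p)%:R = p%:R :> R.
Proof.
move=> hp; rewrite (sum_cut _ hp).
rewrite [X in _ + X]big_nat_cond [X in _ + X]big1 ?addr0; last first.
  by move=> i /andP[/andP[hi _] _]; rewrite ltnNge hi.
rewrite (eq_big_nat _ _ (F2 := fun=> 1)); last by move=> i /andP[_ ->].
by rewrite big_const_nat subn0 iter_addr_0.
Qed.

(** The cubic is the condition that the coordinates do sum to r.  It depends on p and
    q only through their sum, product and minimum, which is why a hook and its
    transpose share the root r. *)
Lemma hook_vec_invariant (R : realFieldType) (n p q : nat) (r : R) :
  (p < n)%N -> (q < n)%N -> 0 < r -> (minn p q)%:R < r ->
  (n%:R - r) * (r ^+ 2 + r - (minn p q)%:R) =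
    (p + q + 1)%:R * r - (p * q + minn p q)%:R ->
  \sum_(0 <= i < n) hook_vec p q r i = r /\
  forall j, (j < n)%N ->
    \sum_(0 <= i < n) (hook_rel p q i j)%:R * hook_vec p q r i =
      r - r * hook_vec p q r j.
Proof.
case: n => // n; rewrite !ltnS => pn qn r0 mr E.
set g := hook_end p q r.
have D0 : r ^+ 2 + r - (minn p q)%:R != 0.
  by rewrite gt_eqF //; have := exprn_gt0 2 r0; lra.
have rn0 : r != 0 by rewrite gt_eqF.
have mn : (minn p q <= n)%N by lia.
split.
  rewrite big_nat_recl //= -/g sumrB -mulr_suml sum_initial // big_const_nat subn0 iter_addr_0.
  have -> : n%:R = n.+1%:R - 1 :> R by rewrite -natr1 addrK.
  apply/eqP; rewrite -subr_eq0; apply/eqP.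
  have -> : (n.+1%:R : R) = r + ((p + q + 1)%:R * r - (p * q + minn p q)%:R) /
    (r ^+ 2 + r - (minn p q)%:R) by rewrite -E mulfK // addrC subrK.
  rewrite /g /hook_end !natrD natrM; field.
  by rewrite rn0 D0.
case=> [|j] hj /=.
  rewrite big_nat_recl //= mul1r -/g.
  have -> : \sum_(0 <= i < n) (hook_rel p q i.+1 0)%:R * (1 - (i < p)%:R * (g / r)) =
     q%:R - (minn p q)%:R * (g / r) :> R.
    rewrite -(sum_initial R qn) -(sum_initial R mn) mulr_suml -sumrB.
    apply: eq_bigr => i _; rewrite /hook_rel /= leq_min.
    by case: (i < p)%N; case: (i < q)%N => /=; ring.
  by rewrite /g /hook_end; field; rewrite rn0 D0.
rewrite big_nat_recl //= -/g [X in _ + X]big1 ?addr0.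
  by rewrite /hook_rel /= orbF; case: (j < p)%N => /=; field.
by move=> i _; rewrite /hook_rel /= mul0r.
Qed.

Lemma hook_end_bounds (R : realFieldType) (p q : nat) (r : R) :
  1 <= r -> p%:R <= r -> q%:R <= r -> 0 <= hook_end p q r <= r.
Proof.
move=> r1 pr qr.
have mp : (minn p q)%:R <= p%:R :> R by rewrite ler_nat; lia.
have mq : (minn p q)%:R <= q%:R :> R by rewrite ler_nat; lia.
have q0 : 0 <= q%:R :> R by exact: ler0n.
have r20 : 1 <= r ^+ 2 by rewrite exprn_ege1.
have D0 : 1 <= r ^+ 2 + r - (minn p q)%:R by lra.
apply/andP; split; first by rewrite /hook_end divr_ge0 ?mulr_ge0 //; lra.
rewrite /hook_end ler_pdivrMr; last by lra.
rewrite mulrC ler_wpM2l; lra.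
Qed.

Lemma hook_vec_ge0 (R : realFieldType) (p q : nat) (r : R) (j : nat) :
  1 <= r -> p%:R <= r -> q%:R <= r -> 0 <= hook_vec p q r j.
Proof.
move=> r1 pr qr; case/andP: (hook_end_bounds r1 pr qr) => g0 g1.
case: j => [|j] //=; have : hook_end p q r / r <= 1.
  by rewrite ler_pdivrMr ?mul1r //; lra.
by case: (j < p)%N => /=; lra.
Qed.

(** With one two-step walk less than the hook, the terms of order 1/r^2 differ by at
    least 1/r^2, which beats everything of higher order.  Here s + c is the count
    for the hook and P the smaller one. *)
Lemma fewer_paths_arith (R : realFieldType) (n s c a P r : R) :
  1 <= r -> 0 <= a -> 0 <= P -> P + 1 <= s + c -> s * a + P <= r -> a <= r ->
  (n - r) * (r ^+ 2 + r - a) = s * r - c -> n - s / r + P / r ^+ 2 <= r.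
Proof.
move=> r1 a0 P0 hP hr ar E.
have r20 : 1 <= r ^+ 2 by rewrite exprn_ege1.
have D0 : 0 < r ^+ 2 + r - a by lra.
have -> : n = r + (s * r - c) / (r ^+ 2 + r - a).
  by rewrite -E mulfK ?gt_eqF // addrC subrK.
suff : (s * r - c) / (r ^+ 2 + r - a) <= (s * r - P) / r ^+ 2.
  have -> : (s * r - P) / r ^+ 2 = s / r - P / r ^+ 2.
    by field; rewrite gt_eqF //; lra.
  lra.
rewrite ler_pdivrMr // mulrAC ler_pdivlMr; last by lra.
rewrite -subr_ge0.
have -> : (s * r - P) * (r ^+ 2 + r - a) - (s * r - c) * r ^+ 2 =
  r ^+ 2 * (s + c - (P + 1)) + r * (r - (s * a + P)) + P * a by ring.
rewrite !addr_ge0 // mulr_ge0 //; lra.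
Qed.

(** The Neumann series for the staircase of rows 3, 2, 1, cut after order 4: the
    coefficients are the entries of the first four powers of its matrix applied to
    the all-ones vector, up to sign, and in each order they sum to the number of walks 6, 14,
    31, 70. *)
Definition staircase_vec (R : realFieldType) (r : R) (j : nat) : R :=
  let h := r^-1 in
  match j with
  | 0 => 1 - 3 * h + 6 * h ^+ 2 - 14 * h ^+ 3 + 31 * h ^+ 4
  | 1 => 1 - 2 * h + 5 * h ^+ 2 - 11 * h ^+ 3 + 25 * h ^+ 4
  | 2 => 1 - h + 3 * h ^+ 2 - 6 * h ^+ 3 + 14 * h ^+ 4
  | _ => 1
  end.

Lemma staircase_vec_gt0 (R : realFieldType) (r : R) (j : nat) :
  8 <= r -> 0 < staircase_vec r j.
Proof.
move=> r8; have h0 : 0 < r^-1 by rewrite invr_gt0; lra.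
have h8 : r^-1 * 8 <= 1 by rewrite mulrC ler_pdivrMr; lra.
case: j => [|[|[|j]]] //=; move: (r^-1) h0 h8 => h h0 h8.
- have -> : 1 - 3 * h + 6 * h ^+ 2 - 14 * h ^+ 3 + 31 * h ^+ 4 =
    (1 - 3 * h) + h ^+ 2 * (6 - 14 * h) + 31 * h ^+ 4 by ring.
  have := exprn_gt0 2 h0; have := exprn_gt0 4 h0; nra.
- have -> : 1 - 2 * h + 5 * h ^+ 2 - 11 * h ^+ 3 + 25 * h ^+ 4 =
    (1 - 2 * h) + h ^+ 2 * (5 - 11 * h) + 25 * h ^+ 4 by ring.
  have := exprn_gt0 2 h0; have := exprn_gt0 4 h0; nra.
- have -> : 1 - h + 3 * h ^+ 2 - 6 * h ^+ 3 + 14 * h ^+ 4 =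
    (1 - h) + h ^+ 2 * (3 - 6 * h) + 14 * h ^+ 4 by ring.
  have := exprn_gt0 2 h0; have := exprn_gt0 4 h0; nra.
Qed.

(** The cubic is that of the hook with arms 2 and 3.  It agrees with the staircase
    up to 14/r^2, but the staircase has w3 = 31 against 26. *)
Lemma staircase_vec_sum (R : realFieldType) (n : nat) (r : R) :
  (2 < n)%N -> 8 <= r ->
  (n%:R - r) * (r ^+ 2 + r - 2) = 6 * r - 8 ->
  \sum_(0 <= i < n) staircase_vec r i <= r.
Proof.
case: n => [|[|[|n]]] // _ r8 E.
rewrite 3?big_nat_recl //= big_const_nat subn0 iter_addr_0.
have D0 : 0 < r ^+ 2 + r - 2 by nra.
have -> : n%:R = r - 3 + (6 * r - 8) / (r ^+ 2 + r - 2).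
  by rewrite -E mulfK ?gt_eqF // -(addn3 n) natrD; ring.
suff : (6 * r - 8) / (r ^+ 2 + r - 2) <=
    (6 * r ^+ 3 - 14 * r ^+ 2 + 31 * r - 70) / r ^+ 4.
  have -> : (6 * r ^+ 3 - 14 * r ^+ 2 + 31 * r - 70) / r ^+ 4 =
      6 * r^-1 - 14 * r^-1 ^+ 2 + 31 * r^-1 ^+ 3 - 70 * r^-1 ^+ 4.
    by field; rewrite gt_eqF //; lra.
  lra.
rewrite ler_pdivrMr // mulrAC ler_pdivlMr; last by rewrite exprn_gt0; lra.
rewrite -subr_ge0.
have -> : (6 * r ^+ 3 - 14 * r ^+ 2 + 31 * r - 70) * (r ^+ 2 + r - 2)
   - (6 * r - 8) * r ^+ 4 =
  r ^+ 2 * (5 * (r - 8)) + r * (29 * (r - 8) + 100) + 140 by ring.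
by rewrite !addr_ge0 // mulr_ge0 ?sqr_ge0 //; lra.
Qed.

Lemma staircase_vec_col (R : realFieldType) (n j : nat) (r : R) :
  (2 < n)%N -> 8 <= r ->
  r - \sum_(0 <= i < n) (i + j <= 2)%N%:R * staircase_vec r i <= r * staircase_vec r j.
Proof.
case: n => [|[|[|n]]] // _ r8.
rewrite 3?big_nat_recl //= big1 ?addr0; last first.
  by move=> i _; rewrite mul0r.
have h1 : r * r^-1 = 1 by rewrite divff // gt_eqF //; lra.
have h0 : 0 < r^-1 by rewrite invr_gt0; lra.
have h4 : 0 < r^-1 ^+ 4 by exact: exprn_gt0.
have h2 : r * r^-1 ^+ 2 = r^-1 by rewrite expr2 mulrA h1 mul1r.
have h3 : r * r^-1 ^+ 3 = r^-1 ^+ 2 by rewrite exprS mulrA h1 mul1r.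
have h5 : r * r^-1 ^+ 4 = r^-1 ^+ 3 by rewrite exprS mulrA h1 mul1r.
case: j => [|[|[|j]]] /=; move: (r^-1) h1 h0 h4 h2 h3 h5 => h h1 h0 h4 h2 h3 h5; lra.
Qed.

(** The case where no cell lies outside the n x n square. *)
Lemma square_bound (R : realFieldType) (n N a b : nat) (Y : rel nat) (rho r : R)
  (x : nat -> R) :
  (a <= b <= a.+1)%N -> (a + b + 1)%N <> 4%N ->
  (b.+2 < n)%N -> (n <= N)%N -> (8 + 2 * (a + b + 1) ^ 2 + 2 * (a + b + 1))%:R <= r ->
  (n%:R - r) * (r ^+ 2 + r - a%:R) = (a + b + 1)%:R * r - (a * b + a)%:R ->
  downset Y -> (forall i j, Y i j -> (i < n)%N /\ (j < n)%N) ->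
  subinvariant N Y rho x ->
  cells n (corner_compl n Y) = (a + b + 1)%N ->
  rho <= r.
Proof.
move=> hab h4 bn nN hr E dY Ysup sx cC.
have dC := downset_corner_compl (n := n) dY.
have n0N : (0 < n <= N)%N by lia.
have [n' en] : exists n', n = n'.+1 by exists n.-1; lia.
have C00 : corner_compl n Y 0%N 0%N.
  by apply/negPn/negP => /(cells_empty n dC)[]; rewrite cC; lia.
have small k : (k <= 8 + 2 * (a + b + 1) ^ 2 + 2 * (a + b + 1))%N -> k%:R <= r.
  by move=> h; apply: le_trans hr; rewrite ler_nat.
have r8 : 8 <= r by apply: (small 8%N); lia.
move: (cC); rewrite {1}en => cC'.
have := paths_lt_hook dC cC' hab h4.
rewrite -en; case.
(* Fewer two-step walks than the hook. *)
- move=> hP.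
  have out0 : (2 * \sum_(n <= v < N) col_len n Y v * row_len n Y v = 0)%N.
    rewrite big_nat_cond big1 ?muln0 // => v /andP[/andP[hv _] _].
    rewrite /row_len big1 ?muln0 // => i _.
    by case Yv: (Y v i) => //; case: (Ysup _ _ Yv); lia.
  apply: (block_test n0N _ sx).
  + by move=> i j hi _; apply/negP => /Ysup[]; lia.
  + lra.
  + rewrite -cells_corner_compl cC.
    have : (a + b + 2)%:R <= r by apply: small; nia.
    by rewrite !natrD; lra.
  + rewrite out0 addn0 -paths_corner_compl.
    have : (paths n (corner_compl n Y))%:R <= r by apply: small; nia.
    by have := ler0n R (paths n (corner_compl n Y)); nra.
  rewrite -cells_corner_compl -paths_corner_compl cC out0 addn0.
  apply: fewer_paths_arith E; rewrite ?ler0n //; first lra.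
  + by rewrite natr1 -natrD ler_nat; lia.
  + by rewrite -natrM -natrD; apply: small; nia.
  + by apply: small; nia.
(* The balanced hook or its transpose: the dual vector is an exact eigenvector. *)
- case=> t0 hpq.
  pose p := row_len n' (fun i j => corner_compl n Y i j.+1) 0.
  pose q := col_len n' (fun i j => corner_compl n Y i.+1 j) 0.
  have mpq : minn p q = a by case: hpq => -[h1 h2]; rewrite /p /q h1 h2; lia.
  have ppq : (p * q)%N = (a * b)%N by case: hpq => -[h1 h2]; rewrite /p /q h1 h2; lia.
  have spq : (p + q)%N = (a + b)%N by case: hpq => -[h1 h2]; rewrite /p /q h1 h2; lia.
  have hp : (p <= b)%N by lia.
  have hq : (q <= b)%N by lia.
  have br : b%:R <= r by apply: small; nia.
  have ar : (minn p q)%:R < r.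
    by rewrite mpq; apply: lt_le_trans (small a.+1 _); rewrite ?ltr_nat; nia.
  have Epq : (n%:R - r) * (r ^+ 2 + r - (minn p q)%:R) =
      (p + q + 1)%:R * r - (p * q + minn p q)%:R by rewrite mpq ppq spq.
  have [|||Ssum Scol] := hook_vec_invariant _ _ _ ar Epq; try lia; first by lra.
  have pr : p%:R <= r by apply: le_trans br; rewrite ler_nat.
  have qr : q%:R <= r by apply: le_trans br; rewrite ler_nat.
  apply: (square_test (y := hook_vec p q r) n0N Ysup sx).
  + by move=> i _; apply: hook_vec_ge0 => //; lra.
  + have -> : n.-1 = n.-2.+1 by lia.
    have -> : hook_vec p q r n.-2.+1 = 1; last by [].
    by rewrite /= ltnNge (_ : p <= n.-2)%N ?mul0r ?subr0 //; lia.
  + by rewrite Ssum.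
  move=> j hj; rewrite (eq_big_nat _ _
     (F2 := fun i => (hook_rel p q i j)%:R * hook_vec p q r i)).
    by rewrite Scol //; lra.
  move=> i /andP[_ hi]; rewrite (hook_shape dC C00 t0 (erefl p) (erefl q)) //; lia.
(* The staircase, with s = 6. *)
move=> [t1 hp hq ea eb].
apply: (square_test (y := staircase_vec r) n0N Ysup sx).
- by move=> i _; apply/ltW/staircase_vec_gt0.
- exact: staircase_vec_gt0.
- by apply: staircase_vec_sum => //; [lia | move: E; rewrite ea eb].
move=> j hj; rewrite (eq_big_nat _ _
   (F2 := fun i => (i + j <= 2)%N%:R * staircase_vec r i)).
  by apply: staircase_vec_col => //; lia.
by move=> i /andP[_ hi]; rewrite (staircase_shape dC C00 t1 hp hq) //; lia.
Qed.


(** * The Durfee square and its arms *)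

Lemma row_len_cut (n N : nat) (Y : rel nat) (i : nat) : (n <= N)%N ->
  (forall j, (n <= j)%N -> ~~ Y i j) -> row_len N Y i = row_len n Y i.
Proof.
move=> nN h; rewrite /row_len (big_cat_nat _ nN) //= [X in (_ + X)%N]big_nat_cond.
rewrite [X in (_ + X)%N]big1 ?addn0 // => j /andP[/andP[hj _] _].
by rewrite (negbTE (h _ hj)).
Qed.

Lemma col_len_cut (n N : nat) (Y : rel nat) (j : nat) : (n <= N)%N ->
  (forall i, (n <= i)%N -> ~~ Y i j) -> col_len N Y j = col_len n Y j.
Proof.
move=> nN h; rewrite /col_len (big_cat_nat _ nN) //= [X in (_ + X)%N]big_nat_cond.
rewrite [X in (_ + X)%N]big1 ?addn0 // => i /andP[/andP[hi _] _].
by rewrite (negbTE (h _ hi)).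
Qed.

(** For an index v outside the block, the cells of the block rows in column v and of
    the block columns in row v. *)
Definition arm (n : nat) (Y : rel nat) (v : nat) : nat :=
  (col_len n Y v + row_len n Y v)%N.

Definition arms (n N : nat) (Y : rel nat) : nat :=
  (\sum_(n <= v < N) arm n Y v)%N.

Lemma cells_block (n N : nat) (Y : rel nat) : (n <= N)%N ->
  (forall i j, (n <= i)%N -> (n <= j)%N -> ~~ Y i j) ->
  cells N Y = (cells n Y + arms n N Y)%N.
Proof.
move=> nN out; rewrite /arms /arm big_split /= addnA /cells (big_cat_nat _ nN) //=.
congr (_ + _)%N; last first.
  apply: eq_big_nat => i /andP[hi _]; apply: row_len_cut => // j.
  exact: out.
rewrite /row_len.
have -> : (\sum_(n <= j < N) col_len n Y j = \sum_(0 <= i < n) \sum_(n <= j < N) Y i j)%N.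
  by rewrite exchange_big_nat.
by rewrite -big_split /=; apply: eq_bigr => i _; rewrite (big_cat_nat _ nN).
Qed.

Lemma cells_neg (n : nat) (Y : rel nat) :
  (cells n Y + cells n (fun i j => ~~ Y i j) = n * n)%N.
Proof.
rewrite /cells /row_len -big_split /=.
transitivity (\sum_(0 <= i < n) \sum_(0 <= j < n) 1)%N; last first.
  by rewrite !sum_nat_const_nat !subn0 muln1.
apply: eq_bigr => i _; rewrite -big_split /=.
by apply: eq_bigr => j _; case: (Y i j).
Qed.

Lemma cells_full (d : nat) (Y : rel nat) :
  (forall i j, (i < d)%N -> (j < d)%N -> Y i j) -> cells d Y = (d * d)%N.
Proof.
move=> full; rewrite -(cells_neg d Y) [X in (_ + X)%N]/cells big_nat_cond big1 ?addn0 //.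
move=> i /andP[/andP[_ hi] _]; rewrite /row_len big_nat_cond big1 // => j /andP[/andP[_ hj] _].
by rewrite full.
Qed.

(** The case of Cauchy-Schwarz with an indicator: (t f_i - x_i f_i)^2 >= 0 summed over
    i, at the optimal t. *)
Lemma cauchy_indicator (R : realFieldType) (d : nat) (f : nat -> bool) (x : nat -> R) :
  (\sum_(0 <= i < d) (f i)%:R * x i) ^+ 2 <=
    ((\sum_(0 <= i < d) f i)%N)%:R * \sum_(0 <= i < d) x i ^+ 2.
Proof.
set A := \sum_(0 <= i < d) _ * _; set Q := \sum_(0 <= i < d) _ ^+ 2.
set c := (\sum_(0 <= i < d) f i)%N.
have key t : 2 * t * A <= t ^+ 2 * c%:R + Q.
  rewrite /A /Q /c natr_sum_nat !mulr_sumr -big_split /=.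
  apply: ler_sum_nat => i _; case: (f i) => /=; have := sqr_ge0 (t - x i);
    have := sqr_ge0 (x i); nra.
have [c0|c0] := posnP c.
  have -> : A = 0.
    rewrite /A big_nat_cond big1 // => i /andP[/andP[_ hi] _].
    case fi: (f i); last by rewrite mul0r.
    move/eqP: c0; rewrite /c big_mkord sum_nat_eq0 => /forallP /(_ (Ordinal hi)) /=.
    by rewrite fi.
  rewrite expr0n /= mulr_ge0 ?ler0n //; apply: sumr_ge0 => i _; exact: sqr_ge0.
have c0' : 0 < c%:R :> R by rewrite ltr0n.
have := key (A / c%:R).
have -> : 2 * (A / c%:R) * A = 2 * (A ^+ 2 / c%:R) by ring.
have -> : (A / c%:R) ^+ 2 * c%:R = A ^+ 2 / c%:R by field; rewrite gt_eqF.
move=> h; have {h} : A ^+ 2 / c%:R <= Q by lra.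
by rewrite ler_pdivrMr // mulrC.
Qed.

Lemma inner_row (R : realFieldType) (d N i : nat) (Y : rel nat) (r : R)
  (x : nat -> R) :
  (d <= N)%N -> (forall i j, (i < d)%N -> (j < d)%N -> Y i j) ->
  subinvariant N Y r x -> (i < d)%N ->
  r * x i <= \sum_(0 <= j < d) x j + \sum_(d <= v < N) (Y i v)%:R * x v.
Proof.
move=> dN full [_ _ _ hx] hi; apply: le_trans (hx i) _.
rewrite (sum_cut _ dN) lerD2r.
by apply: ler_sum_nat => j /andP[_ hj]; rewrite full // mul1r.
Qed.

Lemma outer_row (R : realFieldType) (d N v : nat) (Y : rel nat) (r : R)
  (x : nat -> R) :
  (d <= N)%N -> (forall i j, (d <= i)%N -> (d <= j)%N -> ~~ Y i j) ->
  subinvariant N Y r x -> (d <= v)%N ->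
  r * x v <= \sum_(0 <= j < d) (Y v j)%:R * x j.
Proof.
move=> dN out [_ _ _ hx] hv; apply: le_trans (hx v) _; rewrite (sum_cut _ dN).
rewrite [X in _ + X]big_nat_cond [X in _ + X]big1 ?addr0 //.
by move=> j /andP[/andP[hj _] _]; rewrite (negbTE (out _ _ hv hj)) mul0r.
Qed.

(** Write the vector as (u, v) along the block and the matrix as [J B; C 0].  Then
    r^2 u <= r J u + B C u; pair this with u.  The first term is at most r d |u|^2,
    and |B^T u| |C u| is at most the mean of the squares, that is half the number of
    cells of B and C times |u|^2. *)
Lemma durfee_square (R : realFieldType) (d N : nat) (Y : rel nat) (r : R)
  (x : nat -> R) :
  (0 < d <= N)%N -> (forall i j, (i < d)%N -> (j < d)%N -> Y i j) ->
  (forall i j, (d <= i)%N -> (d <= j)%N -> ~~ Y i j) -> 0 <= r ->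
  subinvariant N Y r x ->
  2 * r ^+ 2 <= 2 * r * d%:R + (arms d N Y)%:R.
Proof.
move=> /andP[d0 dN] full out r0 sx; have [x0 xd xp _] := sx.
pose Q := \sum_(0 <= i < d) x i ^+ 2.
have Q0 : 0 < Q.
  apply: lt_le_trans (term_le_sum (j := 0%N) (F := fun i => x i ^+ 2) _ d0).
    by rewrite exprn_gt0.
  by move=> i _; apply: sqr_ge0.
pose U := \sum_(0 <= i < d) x i.
pose Cv v := \sum_(0 <= i < d) (Y i v)%:R * x i.
pose Rv v := \sum_(0 <= i < d) (Y v i)%:R * x i.
have hU : U ^+ 2 <= d%:R * Q.
  have := cauchy_indicator d (fun=> true) x.
  rewrite sum_nat_const_nat subn0 muln1 /U -/Q.
  by under eq_bigr do rewrite mul1r.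
have hC v : Cv v ^+ 2 <= (col_len d Y v)%:R * Q by exact: cauchy_indicator.
have hR v : Rv v ^+ 2 <= (row_len d Y v)%:R * Q by exact: cauchy_indicator.
have xin i : (i < d)%N -> r * x i <= U + \sum_(d <= v < N) (Y i v)%:R * x v.
  exact: inner_row dN full sx.
have xout v : (d <= v)%N -> r * x v <= Rv v.
  exact: outer_row dN out sx.
have step1 : r ^+ 2 * Q <= r * U ^+ 2 + \sum_(d <= v < N) Cv v * Rv v.
  have -> : r ^+ 2 * Q = r * \sum_(0 <= i < d) x i * (r * x i).
    by rewrite /Q !mulr_sumr; apply: eq_bigr => i _; ring.
  apply: (@le_trans _ _ (r * \sum_(0 <= i < d) x i *
       (U + \sum_(d <= v < N) (Y i v)%:R * x v))).
    by rewrite ler_wpM2l //; apply: ler_sum_nat => i /andP[_ hi]; rewrite ler_wpM2l ?xin.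
  under eq_bigr do rewrite mulrDr.
  rewrite big_split /= -mulr_suml -/U -expr2 mulrDr lerD2l mulr_sumr.
  have -> : \sum_(0 <= i < d) r * (x i * \sum_(d <= v < N) (Y i v)%:R * x v) =
      \sum_(d <= v < N) Cv v * (r * x v).
    under eq_bigr do rewrite !mulr_sumr.
    rewrite exchange_big_nat /=; apply: eq_bigr => v _.
    by rewrite /Cv mulr_suml; apply: eq_bigr => i _; ring.
  apply: ler_sum_nat => v /andP[hv _]; rewrite ler_wpM2l ?xout //.
  by apply: sumr_ge0 => i _; rewrite mulr_ge0.
have step2 : 2 * \sum_(d <= v < N) Cv v * Rv v <= (arms d N Y)%:R * Q.
  rewrite /arms natr_sum_nat mulr_suml mulr_sumr; apply: ler_sum_nat => v _.
  rewrite /arm natrD; have := sqr_ge0 (Cv v - Rv v); have := hC v; have := hR v; nra.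
rewrite -(ler_pM2r Q0); have : r * U ^+ 2 <= r * (d%:R * Q) by rewrite ler_wpM2l.
lra.
Qed.

(** Sum the same inequalities over the block instead of pairing with u, with x_0 as a
    bound for every coordinate; the last factor on the left is the price of comparing
    x_0 with the sum over the block. *)
Lemma arms_product (R : realFieldType) (d N : nat) (Y : rel nat) (r : R)
  (x : nat -> R) :
  (0 < d <= N)%N -> (forall i j, (i < d)%N -> (j < d)%N -> Y i j) ->
  (forall i j, (d <= i)%N -> (d <= j)%N -> ~~ Y i j) -> 0 <= r -> d%:R <= r ->
  subinvariant N Y r x ->
  (r - d%:R) * (r ^+ 2 - (arms d N Y)%:R) <=
    ((\sum_(d <= v < N) col_len d Y v * row_len d Y v)%N)%:R.
Proof.
move=> /andP[d0 dN] full out r0 dr sx; have [x0 xd xp _] := sx.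
set T := (\sum_(d <= v < N) _)%N.
pose U := \sum_(0 <= i < d) x i.
have xin i : (i < d)%N -> r * x i <= U + \sum_(d <= v < N) (Y i v)%:R * x v.
  exact: inner_row dN full sx.
have xout v : (d <= v)%N -> r * x v <= (row_len d Y v)%:R * x 0%N.
  move=> hv; apply: le_trans (outer_row dN out sx hv) _.
  rewrite /row_len natr_sum_nat mulr_suml; apply: ler_sum_nat => j _.
  by rewrite ler_wpM2l // xd.
have s1 : r * (r - d%:R) * U <= x 0%N * T%:R.
  have : r * U <= d%:R * U + \sum_(d <= v < N) (col_len d Y v)%:R * x v.
    rewrite {1}/U mulr_sumr.
    apply: (@le_trans _ _ (\sum_(0 <= i < d) (U + \sum_(d <= v < N) (Y i v)%:R * x v))).
      by apply: ler_sum_nat => i /andP[_ hi]; apply: xin.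
    rewrite big_split /= big_const_nat subn0 iter_addr_0 mulr_natl lerD2l.
    rewrite exchange_big_nat /=; apply: ler_sum_nat => v _.
    by rewrite -mulr_suml /col_len natr_sum_nat.
  have : r * \sum_(d <= v < N) (col_len d Y v)%:R * x v <= x 0%N * T%:R.
    rewrite /T natr_sum_nat !mulr_sumr; apply: ler_sum_nat => v /andP[hv _].
    rewrite natrM [x 0%N * _]mulrC -[X in _ <= X]mulrA [r * _]mulrCA.
    by rewrite ler_wpM2l ?ler0n ?xout.
  move: (\sum_(d <= v < N) _) => S h1 h2.
  have : r * (r * U) <= r * (d%:R * U + S) by rewrite ler_wpM2l.
  lra.
have s2 : (r ^+ 2 - (arms d N Y)%:R) * x 0%N <= r * U.
  have h0 := xin _ d0.
  have h1 : \sum_(d <= v < N) (Y 0%N v)%:R * x v <= \sum_(d <= v < N) x v.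
    by apply: ler_sum_nat => v _; case: (Y 0%N v); rewrite /= ?mul1r ?mul0r.
  have h2 : r * \sum_(d <= v < N) x v <= (arms d N Y)%:R * x 0%N.
    rewrite /arms natr_sum_nat mulr_sumr mulr_suml; apply: ler_sum_nat => v /andP[hv _].
    apply: le_trans (xout _ hv) _; by rewrite ler_wpM2r // ler_nat leq_addl.
  have : r * (r * x 0%N) <= r * (U + \sum_(d <= v < N) x v).
    by rewrite ler_wpM2l //; lra.
  lra.
rewrite -(ler_pM2r xp).
have : (r - d%:R) * ((r ^+ 2 - (arms d N Y)%:R) * x 0%N) <= (r - d%:R) * (r * U).
  by rewrite ler_wpM2l // subr_ge0.
lra.
Qed.


Lemma leq_term_sum (m N v : nat) (F : nat -> nat) : (m <= v < N)%N ->
  (F v <= \sum_(m <= i < N) F i)%N.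
Proof.
move=> hv; rewrite (bigD1_seq v) ?leq_addr ?iota_uniq //=.
by rewrite mem_index_iota.
Qed.

Lemma durfee_exists (N : nat) (Y : rel nat) :
  downset Y -> (forall i j, Y i j -> (i < N)%N /\ (j < N)%N) ->
  exists2 d, (d <= N)%N &
    (forall i j, (i < d)%N -> (j < d)%N -> Y i j) /\
    (forall i j, (d <= i)%N -> (d <= j)%N -> ~~ Y i j).
Proof.
move=> dY supp; have exP : exists d, ~~ Y d d.
  by exists N; apply/negP => /supp[]; rewrite ltnn.
case: (ex_minnP exP) => d nd dmin; exists d.
  by apply: dmin; apply/negP => /supp[]; rewrite ltnn.
split=> i j hi hj; last by apply: contra nd; apply: dY.
have Yd : Y d.-1 d.-1 by apply: contraT => /dmin; lia.
by apply: dY Yd; lia.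
Qed.

Lemma arm_antitone (n v w : nat) (Y : rel nat) :
  downset Y -> (w <= v)%N -> (arm n Y v <= arm n Y w)%N.
Proof.
move=> dY wv; apply: leq_add; apply: leq_sum => i _.
  by case Y1: (Y i v) => //; rewrite (dY _ _ _ _ (leqnn _) wv Y1).
by case Y1: (Y v i) => //; rewrite (dY _ _ _ _ wv (leqnn _) Y1).
Qed.

(** Since f = n^2 - s - d^2, the hypothesis on f reads r^2 + (r - d)^2 <= n^2 - s, and
    n^2 - r^2 is about 2s; hence (r - d)^2 <= s + 1. *)
Lemma durfee_arith (R : realFieldType) (n d s f r : R) :
  0 <= s -> f = n ^+ 2 - s - d ^+ 2 -> n - 1 <= r <= n -> (n - r) * r <= s ->
  2 * r ^+ 2 <= 2 * r * d + f -> n - d <= s + 2.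
Proof.
move=> s0 fE /andP[r1 r2] er h.
rewrite leNgt; apply/negP => hd.
have hrd : s + 1 < r - d by lra.
have : (s + 1) ^+ 2 < (r - d) ^+ 2 by rewrite ltr_pXn2r ?nnegrE //; lra.
have : (n - r) ^+ 2 <= 1 by nra.
nra.
Qed.

(** The number f of cells in the arms is about 2 n (n - d), and T is nearly its
    largest possible value f d / 2: the defect is of order n, not n^2. *)
Lemma arms_product_arith (R : realFieldType) (n d s f r T C : R) :
  0 <= s -> f = n ^+ 2 - s - d ^+ 2 -> n - 1 <= r <= n -> (n - r) * r <= s ->
  0 <= d -> d <= n - 1 -> 0 <= f ->
  n - d <= s + 2 -> 4 * s + 4 * (s + 2) * (s + 3) <= C ->
  (r - d) * (r ^+ 2 - f) <= T -> f * d <= 2 * T + C * n.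
Proof.
move=> s0 fE /andP[r1 r2] er d0 dn f0 hd hC hT.
pose D := n - d; pose e := n - r.
have f1 : f <= 2 * D * n by rewrite fE /D; nra.
have h1 : f * d <= 2 * D * n ^+ 2 by rewrite /D in f1 *; nra.
have h2 : D * (n ^+ 2 - 2 * n - 2 * D * n) <= D * (r ^+ 2 - f).
  rewrite ler_wpM2l /D ?subr_ge0 //; first by lra.
  by rewrite -/D; nra.
have h3 : e * (r ^+ 2 - f) <= s * n.
  rewrite /e; have : (n - r) * r * r <= s * r by rewrite ler_wpM2r //; lra.
  nra.
have h4 : D * (1 + D) <= (s + 2) * (s + 3) by rewrite /D; nra.
have E : (r - d) * (r ^+ 2 - f) = D * (r ^+ 2 - f) - e * (r ^+ 2 - f).
  by rewrite /D /e; ring.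
have n0 : 0 <= n by lra.
have h5 : (4 * s + 4 * (D * (1 + D))) * n <= C * n by rewrite ler_wpM2r //; lra.
nra.
Qed.

(** The difference of the two sides is (c - w)^2. *)
Lemma arm_arith (d c w : nat) : (c <= d)%N -> (w <= d)%N ->
  ((c + w) * (2 * d - (c + w)) + 4 * (c * w) <= 2 * d * (c + w))%N.
Proof.
move=> hc hw.
have -> : (2 * d * (c + w) = (c + w) * (2 * d - (c + w)) + (c + w) * (c + w))%N.
  by rewrite -mulnDr subnK 1?mulnC //; lia.
by rewrite leq_add2l mulnn (nat_AGM2 c w).
Qed.

(** One nearly full arm more than n - d would take more cells than the arms have. *)
Lemma spill_arith (n d s f C e : nat) :
  (d <= n)%N -> (n - d <= s + 2)%N -> ((s + 3) * (2 * s + 4 + 4 * C) < n)%N ->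
  e = (d * d + f)%N -> (e + s = n * n)%N ->
  (f < (n.+1 - d) * (2 * d - 4 * C))%N.
Proof.
move=> dn hd nbig cd cE; rewrite ltnNge; apply/negP => hf.
have [D nE] : exists D, n = (d + D)%N by exists (n - d)%N; lia.
subst n; have e1 : (d + D - d = D)%N by lia.
rewrite e1 in hd; have e2 : ((d + D).+1 - d = D.+1)%N by lia.
rewrite e2 in hf.
have h1 : (f + s = 2 * d * D + D * D)%N by move: cd cE; clear; nia.
have h2 : (D.+1 * (2 * d) <= D.+1 * (2 * d - 4 * C) + D.+1 * (4 * C))%N.
  by rewrite -mulnDr leq_mul2l; apply/orP; right; clear; lia.
have h3 : (D.+1 * (D.+1 + 4 * C) <= (s + 3) * (2 * s + 4 + 4 * C))%N.
  by apply: leq_mul; move: hd; clear; lia.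
move: h1 h2 h3 hf nbig; move: (D.+1 * (2 * d - _))%N => X; clear; nia.
Qed.

(** An arm of p cells contributes at least p(2d - p)/2 to the defect of order n found
    in arms_product_arith, so each arm either misses O(1) of its 2d cells or is
    short.  There are at most n - d arms of the first kind, so all arms outside the
    n x n square have fewer than d cells, and each of their cells costs d: their
    number is O(1). *)
Lemma arms_bounded (R : realFieldType) (s n N : nat) (Y : rel nat) (r : R)
  (x : nat -> R) (C := (4 * s + 4 * (s + 2) * (s + 3))%N) :
  (0 < s)%N -> ((s + 3) * (2 * s + 4 + 4 * C) < n)%N -> (n < N)%N ->
  downset Y -> (forall i j, Y i j -> (i < N)%N /\ (j < N)%N) ->
  (cells N Y + s = n * n)%N -> subinvariant N Y r x ->
  n%:R - 1 <= r <= n%:R -> (n%:R - r) * r <= s%:R ->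
  (forall i j, (n <= i)%N -> (n <= j)%N -> ~~ Y i j) /\ (arms n N Y <= 4 * C)%N.
Proof.
move=> s0 nbig nN dY supp cE sx rn er.
have sn : (2 * (s + 3) < n)%N by apply: leq_ltn_trans nbig; lia.
have [d dN [full out]] := durfee_exists dY supp.
have cd := cells_block dN out; rewrite (cells_full full) in cd.
have dn : (d < n)%N by nia.
have d0 : (0 < d)%N.
  rewrite lt0n; apply/eqP => e; subst d.
  by case: (cells_empty N dY (out 0%N 0%N isT isT)) => h _; move: cE; rewrite h; nia.
set f := arms d N Y in cd.
have fR : f%:R = n%:R ^+ 2 - s%:R - d%:R ^+ 2 :> R.
  have : (f + s + d * d)%:R = (n * n)%:R :> R by congr (_%:R); lia.
  by rewrite !natrD !natrM; lra.
have d0N : (0 < d <= N)%N by rewrite d0.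
have s0R : 0 <= s%:R :> R by exact: ler0n.
have dnR : d%:R <= n%:R - 1 :> R by rewrite lerBrDr natr1 ler_nat.
have d0R : 0 <= d%:R :> R by exact: ler0n.
have r0 : 0 <= r by case/andP: rn; lra.
have dR : n%:R - d%:R <= s%:R + 2 :> R.
  exact: (durfee_arith s0R fR rn er (durfee_square d0N full out r0 sx)).
have hd : (n - d <= s + 2)%N by move: dR; rewrite -natrB ?(ltnW dn) // -natrD ler_nat.
set T := (\sum_(d <= v < N) col_len d Y v * row_len d Y v)%N.
have hT : (f * d <= 2 * T + C * n)%N.
  rewrite -(ler_nat R) natrD !natrM.
  apply: (arms_product_arith s0R fR rn er d0R dnR _ dR) => //.
    by rewrite /C !(natrD, natrM) lexx.
  by apply: (arms_product d0N full out r0 _ sx); case/andP: rn; lra.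
have n2d : (n <= 2 * d)%N by move: hd sn dn; clear; lia.
have fE : f = (\sum_(d <= v < N) arm d Y v)%N by [].
have key : (\sum_(d <= v < N) arm d Y v * (2 * d - arm d Y v) <= 2 * C * n)%N.
  suff : (\sum_(d <= v < N) arm d Y v * (2 * d - arm d Y v) + 4 * T <= 2 * d * f)%N.
    by move: hT; clear; nia.
  rewrite /T fE !big_distrr -big_split /=; apply: leq_sum => v _.
  exact: arm_arith (len_le d (Y^~ v)) (len_le d (Y v)).
split; first by move=> i j hi hj; apply: out; apply: leq_trans (ltnW dn) _.
have [pn|pn] := leqP d (arm d Y n).
  exfalso; have := spill_arith (ltnW dn) hd nbig cd cE.
  apply/negP; rewrite -leqNgt.
  have big v : (d <= v < n.+1)%N -> (2 * d - 4 * C <= arm d Y v)%N.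
    move=> /andP[dv vn].
    have pv : (d <= arm d Y v)%N by apply: leq_trans pn (arm_antitone _ dY _).
    have h := leq_trans (leq_term_sum (fun v => arm d Y v * (2 * d - arm d Y v))%N
       (_ : d <= v < N)%N) key.
    have {h} : (arm d Y v * (2 * d - arm d Y v) <= 2 * C * n)%N by apply: h; lia.
    move=> h; suff : (2 * d - arm d Y v <= 4 * C)%N by clear; lia.
    rewrite -(leq_pmul2l d0); apply: (@leq_trans (2 * C * n)).
      by apply: leq_trans h; rewrite leq_mul2r pv orbT.
    by move: n2d; clear; nia.
  rewrite -sum_nat_const_nat fE (@big_cat_nat _ _ _ n.+1 d N) ?(leqW (ltnW dn)) //=.
  apply: leq_trans (leq_addr _ _).
  rewrite big_nat_cond [X in (_ <= X)%N]big_nat_cond; apply: leq_sum => v /andP[hv _].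
  exact: big.
have armsE : arms n N Y = (\sum_(n <= v < N) arm d Y v)%N.
  rewrite /arms; apply: eq_big_nat => v /andP[hv _]; rewrite /arm.
  rewrite (@col_len_cut d n) ?(@row_len_cut d n) ?(ltnW dn) // => i hi;
    apply: out => //; exact: leq_trans (ltnW dn) hv.
rewrite armsE -(leq_pmul2l d0); apply: (@leq_trans (2 * C * n)); last first.
  by move: n2d; clear; nia.
apply: leq_trans key; rewrite (@big_cat_nat _ _ _ n d N) ?(ltnW dn) ?(ltnW nN) //=.
apply: leq_trans (leq_addl _ _); rewrite big_distrr /= big_nat_cond.
rewrite [X in (_ <= X)%N]big_nat_cond; apply: leq_sum => v /andP[/andP[hv _] _].
rewrite mulnC leq_mul2l; apply/orP; right.
by move: (leq_ltn_trans (arm_antitone d dY hv) pn); clear; lia.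
Qed.


(** * Young diagrams with n^2 - s cells *)

(** A bound on the number of cells outside the n x n square. *)
Definition overhang (s : nat) : nat := (4 * (4 * s + 4 * (s + 2) * (s + 3)))%N.

(** A crude value of n beyond which all the comparisons of orders hold. *)
Definition threshold (s : nat) : nat :=
  ((s + 3) * (2 * s + 4 + overhang s) + (s + overhang s) ^ 2 + 2 * overhang s ^ 2
   + 2 * s ^ 2 + 2 * s + 10)%N.

Lemma paths_le_cells (n : nat) (Y : rel nat) : (paths n Y <= cells n Y ^ 2)%N.
Proof.
rewrite /paths -mulnn [X in (_ <= X * _)%N]cells_col big_distrl /=.
rewrite big_nat_cond [X in (_ <= X)%N]big_nat_cond.
apply: leq_sum => j /andP[hj _]; rewrite leq_mul2l; apply/orP; right.
exact: (leq_term_sum (row_len n Y) hj).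
Qed.

(** Each of the k cells outside the square is one more missing inside: a loss of k/r,
    against a gain of at most Q/r^2. *)
Lemma spill_loss_arith (R : realFieldType) (n s k Q r : R) :
  0 < r -> 1 <= k -> 0 <= Q -> Q <= r -> (n - r) * r <= s ->
  n - (s + k) / r + Q / r ^+ 2 <= r.
Proof.
move=> r0 k1 Q0 Qr er; rewrite -subr_ge0.
have -> : r - (n - (s + k) / r + Q / r ^+ 2) =
   ((s - (n - r) * r) * r + (k - 1) * r + (r - Q)) / r ^+ 2.
  by field; rewrite gt_eqF.
have h1 : 0 <= (s - (n - r) * r) * r by rewrite mulr_ge0 ?subr_ge0 // ltW.
have h2 : 0 <= (k - 1) * r by rewrite mulr_ge0 ?subr_ge0 // ltW.
by rewrite divr_ge0 ?sqr_ge0 //; lra.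
Qed.

Lemma young_bound (R : realFieldType) (a b n N : nat) (Y : rel nat) (rho r : R)
  (x : nat -> R) (s := (a + b + 1)%N) :
  (a <= b <= a.+1)%N -> s <> 4%N -> (threshold s <= n)%N -> (n < N)%N ->
  n%:R - 1 <= r <= n%:R ->
  (n%:R - r) * (r ^+ 2 + r - a%:R) = s%:R * r - (a * b + a)%:R ->
  downset Y -> (forall i j, Y i j -> (i < N)%N /\ (j < N)%N) ->
  (cells N Y + s = n * n)%N -> subinvariant N Y rho x ->
  rho <= r.
Proof.
move=> hab h4 nbig nN rn E dY supp cE sx.
rewrite leNgt; apply/negP => rr; suff : rho <= r by rewrite leNgt rr.
have nr : (threshold s)%:R - 1 <= r.
  by case/andP: rn => h _; apply: le_trans h; rewrite lerD2r ler_nat.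
have small k : (k < threshold s)%N -> k%:R <= r.
  by move=> h; apply: le_trans nr; rewrite lerBrDr natr1 ler_nat.
have r1 : 1 <= r by apply: (small 1%N); rewrite /threshold; lia.
have r0 : 0 < r by lra.
have ar : a%:R <= r by apply: small; rewrite /threshold /s; lia.
have er : (n%:R - r) * r <= s%:R.
  rewrite -(ler_pM2r r0); case/andP: rn => _ rn.
  have : 0 <= (n%:R - r) * (r - a%:R) by rewrite mulr_ge0 ?subr_ge0.
  have : 0 <= (a * b + a)%:R :> R by exact: ler0n.
  move: E; nra.
have sr : subinvariant N Y r x.
  case: sx => x0 xd xp hx; split=> // i; apply: le_trans (hx i).
  by rewrite ler_wpM2r // ltW.
have [|| out hk] := arms_bounded _ _ nN dY supp cE sr rn er.
- by rewrite /s addn1.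
- by apply: leq_trans nbig; rewrite /threshold /overhang; lia.
rewrite -/(overhang s) in hk.
have n0N : (0 < n <= N)%N by rewrite (ltnW nN) andbT; move: nbig; rewrite /threshold; lia.
have zc : cells n (fun i j => ~~ Y i j) = (s + arms n N Y)%N.
  have := cells_neg n Y; have := cells_block (ltnW nN) out; lia.
have [k0|k0] := posnP (arms n N Y).
  have zero v : (n <= v < N)%N -> col_len n Y v = 0%N /\ row_len n Y v = 0%N.
    move=> hv; have := leq_term_sum (arm n Y) hv.
    by rewrite -/(arms n N Y) k0 /arm; lia.
  have supn i j : Y i j -> (i < n)%N /\ (j < n)%N.
    move=> Yij; have [iN jN] := supp _ _ Yij.
    have [hi|hi] := ltnP i n; have [hj|hj] := ltnP j n; split=> //.
    + have [|h _] := zero j; first by rewrite hj.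
      have := @leq_term_sum 0 n i (fun i => Y i j : nat); rewrite hi Yij -/(col_len n Y j) h.
      by move=> /(_ isT).
    + have [|_ h] := zero i; first by rewrite hi.
      have := @leq_term_sum 0 n j (fun j => Y i j : nat); rewrite hj Yij -/(row_len n Y i) h.
      by move=> /(_ isT).
    + by move: (out _ _ hi hj); rewrite Yij.
    + by move: (out _ _ hi hj); rewrite Yij.
  apply: (@square_bound _ n N a b Y rho r x) => //.
  - by move: nbig; rewrite /threshold /s; lia.
  - exact: ltnW.
  - by apply: small; rewrite /threshold /s; lia.
  - by rewrite cells_corner_compl zc k0 addn0.
set K := overhang s in hk small *.
have Qle : (paths n (fun i j => ~~ Y i j) +
    2 * \sum_(n <= v < N) col_len n Y v * row_len n Y v < threshold s)%N.
  have h1 : (paths n (fun i j => ~~ Y i j) <= (s + K) ^ 2)%N.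
    by apply: leq_trans (paths_le_cells _ _) _; rewrite zc leq_sqr leq_add2l.
  have h2 : (\sum_(n <= v < N) col_len n Y v * row_len n Y v <= K ^ 2)%N.
    apply: (@leq_trans (arms n N Y * arms n N Y)); last by rewrite mulnn leq_sqr.
    rewrite {1}/arms big_distrl /= big_nat_cond [X in (_ <= X)%N]big_nat_cond.
    apply: leq_sum => v /andP[hv _].
    have := leq_term_sum (arm n Y) hv.
    by rewrite -/(arms n N Y) /arm => h; apply: leq_mul; lia.
  by rewrite /threshold -/K; lia.
have QR := small _ Qle.
apply: (block_test n0N out sx) => //.
- rewrite zc; have : (s + arms n N Y + 1)%:R <= r.
    by apply: small; rewrite /threshold -/K; lia.
  by rewrite natrD; lra.
- by apply: le_trans QR _; rewrite expr2 ler_peMl // ltW.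
rewrite zc natrD; apply: spill_loss_arith => //; by rewrite ler1n.
Qed.


(** * From digraphs to Young diagrams *)
Lemma num_edgesE (V : finType) (e : rel V) :
  num_edges e = (\sum_u \sum_v e u v)%N.
Proof.
rewrite /num_edges cardsE -sum1_card big_mkcond /= pair_bigA /=.
by apply: eq_bigr => -[u v] _ /=; rewrite unfold_in /=; case: (e u v).
Qed.

Lemma real_complex_norm (R : realType) (z : R[i]) : `|z| = (Normc.normc z)%:C%C.
Proof. by rewrite normc_def; case: z. Qed.

Lemma in_spectrum (R : realType) (n : nat) (A : 'M[R]_n) (z : R[i]) :
  (z \in spectrum A) = eigenvalue (map_mx (real_complex R) A) z.
Proof.
rewrite eigenvalue_root_char /spectrum.
case: closed_field_poly_normal => s /=.
by rewrite (monicP (char_poly_monic _)) scale1r => ->; rewrite root_prod_XsubC.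
Qed.

Lemma sum_enum_val (A : nmodType) (V : finType) (F : V -> A) :
  \sum_u F u = \sum_(i < #|V|) F (enum_val i).
Proof. exact: big_enum_val. Qed.

(** Take the moduli of the coordinates of a left eigenvector. *)
Lemma spectrum_modulus (R : realType) (V : finType) (e : rel V) (z : R[i]) :
  z \in spectrum (adjacency R e) ->
  exists x : V -> R, [/\ forall v, 0 <= x v, exists v, 0 < x v &
    forall v, Normc.normc z * x v <= \sum_u (e u v)%:R * x u].
Proof.
rewrite in_spectrum => /eigenvalueP[w hw wn0].
exists (fun v => Normc.normc (w 0 (enum_rank v))).
have nE (t : R[i]) : 0 <= Normc.normc t by case: t => a b; exact: sqrtr_ge0.
split=> [v|| v] //.
  have /rV0Pn[i wi] := wn0; exists (enum_val i); rewrite enum_valK.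
  rewrite lt_neqAle nE andbT eq_sym; apply: contra wi => /eqP h.
  by rewrite -normr_eq0 real_complex_norm h.
have := congr1 (fun m : 'rV_ _ => m 0 (enum_rank v)) hw.
rewrite !mxE => h; rewrite -lecR rmorphM /= -!real_complex_norm -normrM -h.
apply: le_trans (ler_norm_sum _ _ _) _; rewrite rmorph_sum /=.
rewrite [X in _ <= X](sum_enum_val).
apply: ler_sum => i _; rewrite !mxE enum_valK enum_rankK rmorphM /= -real_complex_norm.
by rewrite normrM mulrC; case: (e _ _); rewrite /= ?normr1 ?normr0.
Qed.

Lemma le_digraph_radius (R : realType) (V : finType) (e : rel V) (r : R) (y : V -> R) :
  0 <= r -> (exists v, y v != 0) ->
  (forall v, \sum_u (e u v)%:R * y u = r * y v) -> r <= digraph_radius R e.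
Proof.
move=> r0 [v0 yv0] hy; rewrite /digraph_radius /spectral_radius.
have rE : Normc.normc (r%:C)%C = r.
  by rewrite /Normc.normc /= expr0n /= addr0 sqrtr_sqr ger0_norm.
rewrite -[X in X <= _]rE; apply: le_bigmax_seq => //.
rewrite in_spectrum eigenvalue_root_char -map_char_poly fmorph_root.
rewrite -eigenvalue_root_char; apply/eigenvalueP.
exists (\row_i y (enum_val i)).
  apply/rowP => j; rewrite !mxE -hy [RHS]sum_enum_val.
  by apply: eq_bigr => i _; rewrite !mxE mulrC.
apply/eqP => /rowP /(_ (enum_rank v0)); rewrite !mxE enum_rankK.
by move/eqP: yv0.
Qed.

Lemma digraph_radius_le (R : realType) (V : finType) (e : rel V) (r : R) :
  0 <= r -> (forall z, z \in spectrum (adjacency R e) -> Normc.normc z <= r) ->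
  digraph_radius R e <= r.
Proof.
move=> r0 h; rewrite /digraph_radius /spectral_radius big_seq.
by apply: bigmax_le.
Qed.

Lemma sum_initial_nat (n p : nat) : (p <= n)%N -> (\sum_(0 <= i < n) (i < p) = p)%N.
Proof.
move=> hp; apply/eqP; rewrite -(eqr_nat rat) natr_sum_nat.
by rewrite sum_initial.
Qed.

(** Against a nonincreasing w, any p indices weigh at most as much as the first p:
    compare both sums after subtracting the constant w p. *)
Lemma top_sum (R : realFieldType) (K : nat) (f : nat -> bool) (w : nat -> R) :
  (forall i j, (i <= j)%N -> w j <= w i) ->
  \sum_(0 <= j < K) (f j)%:R * w j <=
    \sum_(0 <= j < (\sum_(0 <= j < K) f j)%N) w j.
Proof.
move=> wd; set p := (\sum_(0 <= j < K) f j)%N.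
have pK : (p <= K)%N by exact: len_le.
have -> : \sum_(0 <= j < p) w j = \sum_(0 <= j < K) (j < p)%:R * (w j - w p) + p%:R * w p.
  rewrite (sum_cut _ pK) [X in _ + X + _]big_nat_cond [X in _ + X + _]big1 ?addr0.
    rewrite [in RHS](eq_big_nat _ _ (F2 := fun j => w j - w p)); last first.
      by move=> j /andP[_ ->]; rewrite mul1r.
    by rewrite sumrB big_const_nat subn0 iter_addr_0 mulr_natl subrK.
  by move=> j /andP[/andP[hj _] _]; rewrite ltnNge hj mul0r.
have -> : \sum_(0 <= j < K) (f j)%:R * w j =
    \sum_(0 <= j < K) (f j)%:R * (w j - w p) + p%:R * w p.
  by rewrite /p natr_sum_nat mulr_suml -big_split; apply: eq_bigr => j _ /=; ring.
rewrite lerD2r; apply: ler_sum_nat => j _.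
have [jp|jp] := ltnP j p.
  have := wd _ _ (ltnW jp); case: (f j) => /=; rewrite ?mul1r ?mul0r; lra.
have := wd _ _ jp; case: (f j) => /=; rewrite ?mul1r ?mul0r; lra.
Qed.

(** Number the vertices by decreasing x, push each row to the left, which can only
    increase its sum, then sort the rows by length.  Cell (i, j) of the result says
    that more than i rows are longer than j.  Row i is at least as long as the
    shortest of the rows 0, ..., i before sorting, whose x is at least that of i.
    The edges are transposed, since x comes from a left eigenvector. *)
Lemma young_rearrangement (R : realType) (V : finType) (e : rel V) (rho : R)
  (x : V -> R) :
  0 <= rho -> (forall v, 0 <= x v) -> (exists v, 0 < x v) ->
  (forall v, rho * x v <= \sum_u (e u v)%:R * x u) ->
  exists (Y : rel nat) (w : nat -> R), [/\ downset Y,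
    (forall i j, Y i j -> (i < #|V|)%N /\ (j < #|V|)%N) &
    forall N, (#|V| <= N)%N -> cells N Y = num_edges e /\ subinvariant N Y rho w].
Proof.
move=> rho0 x0 [v0 xv0] hx.
pose vs := sort (fun u v => x v <= x u) (enum V).
have vsz : size vs = #|V| by rewrite size_sort -cardE.
have sumV (A : nmodType) (F : V -> A) :
    \sum_u F u = \sum_(0 <= k < #|V|) F (nth v0 vs k).
  rewrite -vsz -(big_nth v0 xpredT F) [RHS](perm_big (enum V)) ?big_enum //=.
  by rewrite perm_sort.
pose w k := if (k < #|V|)%N then x (nth v0 vs k) else 0.
have w0 k : 0 <= w k by rewrite /w; case: ifP.
have wd i j : (i <= j)%N -> w j <= w i.
  move=> ij; rewrite /w; case: ifP => hj; last by case: ifP.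
  rewrite (leq_ltn_trans ij hj).
  apply: (@sorted_leq_nth _ (fun u v => x v <= x u)) => //.
  - by move=> a b c h1 h2; apply: le_trans h1.
  - by apply: sort_sorted => u v; apply: le_total.
  - by rewrite inE vsz (leq_ltn_trans ij hj).
  - by rewrite inE vsz.
pose F i j := e (nth v0 vs j) (nth v0 vs i).
pose len i := (\sum_(0 <= j < #|V|) F i j)%N.
have lenV i : (len i <= #|V|)%N by exact: len_le.
have hw i : (i < #|V|)%N -> rho * w i <= \sum_(0 <= j < len i) w j.
  move=> hi; apply: le_trans (top_sum _ (F i) wd).
  have := hx (nth v0 vs i); rewrite sumV {1}/w hi => h; apply: le_trans h _.
  by apply: ler_sum_nat => j /andP[_ hj]; rewrite /w hj.
pose cnt j := (\sum_(0 <= i < #|V|) (j < len i))%N.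
have cntV j : (cnt j <= #|V|)%N by exact: len_le.
pose Y : rel nat := fun i j => (i < cnt j)%N.
exists Y, w; split.
- move=> i j i' j' hi hj; rewrite /Y => h; apply: leq_ltn_trans hi (leq_trans h _).
  by apply: leq_sum => k _; case: (ltnP j (len k)) => // /(leq_ltn_trans hj) ->.
- move=> i j Yij; split; first exact: leq_trans (cntV j).
  rewrite ltnNge; apply/negP => hj; move: Yij; rewrite /Y /cnt big1 // => k _.
  by rewrite ltnNge (leq_trans (lenV k) hj).
move=> N VN; split.
  rewrite cells_col num_edgesE [RHS]exchange_big /= sumV.
  transitivity (\sum_(0 <= j < N) cnt j)%N.
    by apply: eq_bigr => j _; rewrite /col_len sum_initial_nat // (leq_trans (cntV j)).
  rewrite exchange_big_nat /=; apply: eq_bigr => i _.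
  by rewrite sum_initial_nat ?(leq_trans (lenV i)) // sumV.
split=> //.
  have [k hk v0E] : exists2 k, (k < #|V|)%N & v0 = nth v0 vs k.
    exists (index v0 vs); last by rewrite nth_index // mem_sort mem_enum.
    by rewrite -vsz index_mem mem_sort mem_enum.
  by apply: lt_le_trans (wd _ _ (leq0n k)); rewrite /w hk -v0E.
move=> i; have [hi|hi] := ltnP i #|V|; last first.
  rewrite [w i]/w ltnNge hi mulr0; apply: sumr_ge0 => j _.
  by rewrite mulr_ge0.
(* the shortest of the rows 0, ..., i *)
have [i0 i0i imin] : exists2 i0, (i0 <= i)%N & forall k, (k <= i)%N -> (len i0 <= len k)%N.
  case: (@arg_minnP 'I_i.+1 ord0 xpredT (fun k => len k)) => // k _ kmin.
  exists k; first by rewrite -ltnS.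
  by move=> l; rewrite -ltnS => hl; apply: (kmin (Ordinal hl)).
have hi0 := leq_ltn_trans i0i hi.
apply: le_trans (ler_wpM2l rho0 (wd _ _ i0i)) _.
apply: le_trans (hw _ hi0) _.
have lenN := leq_trans (lenV i0) VN.
rewrite (sum_cut _ lenN) -[X in X <= _]addr0 lerD //; last first.
  by apply: sumr_ge0 => j _; rewrite mulr_ge0.
apply: ler_sum_nat => j /andP[_ hj].
suff -> : Y i j by rewrite mul1r.
rewrite /Y /cnt -[X in (X < _)%N]/(i.+1.-1) -ltnS prednK //.
rewrite ltnS -[X in (X <= _)%N](@sum_initial_nat #|V|) //.
rewrite big_nat_cond [X in (_ <= X)%N]big_nat_cond; apply: leq_sum => k _.
case: (ltnP k i.+1) => //; rewrite ltnS => ki.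
by rewrite (leq_trans hj (imin _ ki)).
Qed.


(** * The extremal digraph *)

(** The non-edges of the extremal digraph, counted from its last vertex, form a hook. *)
Lemma Gmpq_hook (m a b : nat) (i j : 'I_m.+1) : (a <= m)%N -> (b <= m)%N ->
  Gmpq m (m - a)%N (m - b)%N i j = ~~ hook_rel b a (m - i)%N (m - j)%N.
Proof.
move=> am bm; rewrite /Gmpq /hook_rel.
have := ltn_ord i; have := ltn_ord j; move: (nat_of_ord i) (nat_of_ord j) => k l; lia.
Qed.

Lemma cells_hook (n p q : nat) : (p < n)%N -> (q < n)%N ->
  cells n (hook_rel p q) = (p + q + 1)%N.
Proof.
case: n => // n pn qn; rewrite cells_peel //.
have -> : row_len n (fun i j => hook_rel p q i j.+1) 0 = p.
  by rewrite /row_len -[RHS](@sum_initial_nat n) //; apply: eq_bigr => j _; rewrite /hook_rel /= orbF.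
have -> : col_len n (fun i j => hook_rel p q i.+1 j) 0 = q.
  by rewrite /col_len -[RHS](@sum_initial_nat n).
by rewrite /cells /row_len big1 ?addn0 // => i _; rewrite big1.
Qed.

Lemma num_edges_Gmpq (m a b : nat) : (a <= m)%N -> (b <= m)%N ->
  (num_edges (Gmpq m (m - a)%N (m - b)%N) + (a + b + 1) = m.+1 * m.+1)%N.
Proof.
move=> am bm.
pose H := hook_rel b a; pose g : rel nat := fun i j => ~~ H (m.+1 - i.+1)%N (m.+1 - j.+1)%N.
have -> : num_edges (Gmpq m (m - a)%N (m - b)%N) = cells m.+1 g.
  rewrite num_edgesE /cells /row_len big_mkord; apply: eq_bigr => i _.
  by rewrite big_mkord; apply: eq_bigr => j _; rewrite Gmpq_hook // /g !subSS.
rewrite -(cells_neg m.+1 g) -cells_corner_compl; congr (_ + _)%N.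
rewrite (addnC a) -(@cells_hook m.+1 b a) //.
apply: eq_big_nat => i /andP[_ hi]; apply: eq_big_nat => j /andP[_ hj].
by rewrite /corner_compl /g hi hj negbK; congr (nat_of_bool (H _ _)); lia.
Qed.

(** The cubic has the equivalent form
    (r - n + 1)(r^2 + r - a) = (r - b)(r - a), which makes its signs at n - 1 and n
    visible. *)
Lemma hook_root_exists (R : realType) (n a b : nat) :
  (a < n)%N -> (b < n)%N ->
  exists2 r : R, n%:R - 1 <= r <= n%:R &
    (n%:R - r) * (r ^+ 2 + r - a%:R) = (a + b + 1)%:R * r - (a * b + a)%:R.
Proof.
move=> an bn.
have aR : a%:R <= n%:R - 1 :> R by rewrite lerBrDr natr1 ler_nat.
have bR : b%:R <= n%:R - 1 :> R by rewrite lerBrDr natr1 ler_nat.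
have a0 : 0 <= a%:R :> R by exact: ler0n.
have b0 : 0 <= b%:R :> R by exact: ler0n.
pose p : {poly R} := ('X - (n%:R - 1)%:P) * ('X ^+ 2 + 'X - (a%:R)%:P)
   - ('X - (b%:R)%:P) * ('X - (a%:R)%:P).
have pE t : p.[t] = (t - (n%:R - 1)) * (t ^+ 2 + t - a%:R) - (t - b%:R) * (t - a%:R).
  by rewrite /p !hornerE.
have [] := @poly_ivt R p (n%:R - 1) n%:R.
- by lra.
- rewrite !pE subrr mul0r sub0r oppr_le0 mulr_ge0 ?subr_ge0 //=.
  have : 0 <= a%:R * (n%:R - 1 - b%:R) :> R by rewrite mulr_ge0 ?subr_ge0.
  have : 0 <= b%:R * n%:R :> R by rewrite mulr_ge0.
  by nra.
move=> r rn /rootP; rewrite pE => h; exists r => //.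
by rewrite !natrD natrM; nra.
Qed.

Lemma Gmpq_radius (R : realType) (m a b : nat) (r : R) :
  (a <= b)%N -> (b.+1 < m)%N -> 1 <= r -> b%:R < r ->
  (m.+1%:R - r) * (r ^+ 2 + r - a%:R) = (a + b + 1)%:R * r - (a * b + a)%:R ->
  r <= digraph_radius R (Gmpq m (m - a)%N (m - b)%N).
Proof.
move=> ab bm r1 br E.
have mab : minn b a = a by lia.
have ar : (minn b a)%:R < r by rewrite mab; apply: le_lt_trans br; rewrite ler_nat.
have E' : (m.+1%:R - r) * (r ^+ 2 + r - (minn b a)%:R) =
    (b + a + 1)%:R * r - (b * a + minn b a)%:R by rewrite mab (addnC b) (mulnC b).
have [|||Ysum Ycol] := hook_vec_invariant _ _ _ ar E'; try lia; first by lra.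
apply: (le_digraph_radius (y := fun i : 'I_m.+1 => hook_vec b a r (m - i)%N)).
- lra.
- exists ord0; rewrite subn0; have -> : m = m.-1.+1 by lia.
  by rewrite /= ltnNge (_ : b <= m.-1)%N ?mul0r ?subr0 ?oner_neq0 //; lia.
move=> j; have jm : (m - j < m.+1)%N by lia.
transitivity (\sum_(0 <= i < m.+1) (hook_vec b a r i -
    (hook_rel b a i (m - j)%N)%:R * hook_vec b a r i)).
  rewrite [RHS]big_nat_rev big_mkord; apply: eq_bigr => i _.
  rewrite Gmpq_hook //; [|lia..]; rewrite add0n subSS.
  by case: (hook_rel _ _ _ _); rewrite /= ?mul1r ?mul0r ?subrr ?subr0.
by rewrite sumrB Ysum Ycol // subKr.
Qed.

(** The s - 1 missing edges other than the loop are split between the last column,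
    which gets a of them, and the last row. *)
Lemma extremal_split (m s : nat) (a := ((s - 1)./2)%N) (b := (s - 1 - a)%N) :
  (0 < s)%N -> (s <= m)%N ->
  [/\ (a <= b <= a.+1)%N, (a + b + 1)%N = s &
     Gml m (2 * m + 1 - s) = Gmpq m (m - a)%N (m - b)%N].
Proof.
move=> s0 sm; rewrite /Gml; have e := odd_double_half (s - 1).
rewrite -/a -muln2 in e.
have h : uphalf (2 * m + 1 - s) = (m - a)%N.
  have := odd_double_half (2 * m + 1 - s); rewrite uphalf_half.
  case: (odd _) => /=; rewrite -muln2; lia.
by split; rewrite ?h; [lia | lia | congr Gmpq; lia].
Qed.

Theorem mainTheorem1 (R : realType) (s : nat) (hs0 : (0 < s)%N) (hs4 : s <> 4%N) :
  exists S : nat, forall m : nat, (S <= m)%N ->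
    num_edges (Gml m (2 * m + 1 - s)) = ((m + 1) ^ 2 - s)%N /\
    forall (V : finType) (e : rel V),
      num_edges e = ((m + 1) ^ 2 - s)%N ->
      digraph_radius R e <= digraph_radius R (Gml m (2 * m + 1 - s)).
Proof.
exists (threshold s) => m mbig.
have sm : (s + 10 <= m)%N by apply: leq_trans mbig; rewrite /threshold; lia.
have [|hab sE GE] := extremal_split hs0 (m := m); first by lia.
rewrite GE; move: ((s - 1)./2) (s - 1 - _)%N hab sE {GE} => a b hab sE.
have /andP[ab ba] := hab.
have am : (a <= m)%N by lia.
have bm : (b <= m)%N by lia.
split; first by have := num_edges_Gmpq am bm; rewrite sE -mulnn addn1; lia.
move=> V e he.
have [|| r rn rE] := @hook_root_exists R m.+1 a b; try lia.
have mR : (s + 10)%:R <= m%:R :> R by rewrite ler_nat.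
have rm : m%:R <= r by case/andP: rn; rewrite -natr1 addrK.
have r0 : 0 <= r by apply: le_trans rm.
apply: (@le_trans _ _ r); last first.
  apply: Gmpq_radius => //; first by lia.
  - by apply: le_trans rm; rewrite ler1n; lia.
  - by apply: lt_le_trans rm; rewrite ltr_nat; lia.
apply: digraph_radius_le => // z /spectrum_modulus[x [x0 xp hx]].
have nz : 0 <= Normc.normc z by case: z {hx} => u v; exact: sqrtr_ge0.
have [Y [w [dY supp hYw]]] := young_rearrangement nz x0 xp hx.
(* Any range works that contains the diagram and exceeds n. *)
have [|cY sub] := hYw (#|V| + m.+2)%N; first by lia.
apply: (young_bound (a := a) (b := b) (n := m.+1) (N := (#|V| + m.+2)%N) _ _ _ _ rn _ dY _ _ sub) => //.
- by rewrite sE.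
- by rewrite sE leqW.
- lia.
- by move=> i j /supp[]; lia.
- by rewrite cY he sE addn1 -mulnn subnK //; nia.
Qed.
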